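(* Let $G$ be a compact Hausdorff topological group, let $X$ be a $G$-ANR, let $Y$ be a metrizable $G$-space, and let $f:X\to Y$ be a $G$-map. Suppose that $f(X)$ is dense in $Y$ and that, for every open cover $\mathcal{U}$ of $Y$, there exists a $G$-map $\varphi:Y\to X$ such that $\varphi f$ is $G$-$f^{-1}(\mathcal{U})$-homotopic to $\mathrm{id}_X$. Then $f$ is a fine $G$-homotopy equivalence, and $Y$ is a $G$-ANR.
   Context: $G$ is a compact Hausdorff topological group. All spaces are completely regular and Hausdorff, and all maps are continuous. A $G$-space is a space with a continuous action of $G$; a $G$-map is a continuous map $f$ with $f(gx)=gf(x)$ for all $g\in G$ and all $x$. A subset $S$ of a $G$-space is invariant if $gs\in S$ for all $g\in G$, $s\in S$. A metrizable $G$-space is a $G$-space whose underlying space is metrizable. $G$-ANR: a metrizable $G$-space $Y$ is a $G$-ANR if for every closed $G$-embedding $Y\hookrightarrow Z$ in a metrizable $G$-space $Z$ there exist an invariant neighborhood $U$ of $Y$ in $Z$ and a $G$-retraction $r:U\to Y$ (i.e. a $G$-map that is the identity on $Y$). $G$-homotopy: with $I=[0,1]$, a $G$-homotopy is a continuous map $F:X\times I\to Y$ that is a $G$-map for the action $g(x,t)=(gx,t)$ on $X\times I$; write $F_t(x)=F(x,t)$. Given an open cover $\mathcal{U}$ of $Y$, a $G$-$\mathcal{U}$-homotopy is a $G$-homotopy $F:X\times I\to Y$ such that for every $x\in X$ there is $U\in\mathcal{U}$ with $F_t(x)\in U$ for all $t\in I$; then $F_0$ and $F_1$ are called $G$-$\mathcal{U}$-homotopic.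 For a map $f:X\to Y$ and an open cover $\mathcal{U}$ of $Y$, $f^{-1}(\mathcal{U})=\{f^{-1}(U)\mid U\in\mathcal{U}\}$, an open cover of $X$. A $G$-map $f:X\to Y$ is a fine $G$-homotopy equivalence if for every open cover $\mathcal{U}$ of $Y$ there is a $G$-map $\varphi:Y\to X$ such that $\varphi f$ is $G$-$f^{-1}(\mathcal{U})$-homotopic to $\mathrm{id}_X$ and $f\varphi$ is $G$-$\mathcal{U}$-homotopic to $\mathrm{id}_Y$. *)

(* Defs.v *)
From HB Require Import structures.
From mathcomp Require Import all_boot all_order all_algebra.
From mathcomp Require Import all_classical all_reals all_analysis.

Set Implicit Arguments.
Unset Strict Implicit.
Unset Printing Implicit Defensive.

Import Order.TTheory GRing.Theory Num.Theory numFieldNormedType.Exports.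

Local Open Scope classical_set_scope.
Local Open Scope ring_scope.

HB.mixin Record isTopologicalGroup G & Topological G & Group G := {
  mulg_continuous : continuous (fun p : G * G => (p.1 * p.2)%g) ;
  invg_continuous : continuous (fun g : G => (g^-1)%g)
}.

#[short(type="topologicalGroupType")]
HB.structure Definition TopologicalGroup :=
  {G of Topological G & Group G & isTopologicalGroup G}.

HB.mixin Record isGSpace (G : topologicalGroupType) X & Topological X := {
  gact : G -> X -> X ;
  gact1 : forall x, gact 1%g x = x ;
  gactM : forall g h x, gact (g * h)%g x = gact g (gact h x) ;
  gact_continuous : continuous (fun p : G * X => gact p.1 p.2)
}.

#[short(type="gSpaceType")]
HB.structure Definition GSpace (G : topologicalGroupType) :=
  {X of Topological X & isGSpace G X}.

Section Metrizable.
Context (R : realType).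

(* The axioms on d are those of the factory isMetric; nonnegativity follows. *)
Definition metrizable (T : topologicalType) :=
  exists d : T -> T -> R,
    [/\ forall x y, d x y = 0 <-> x = y,
        forall x y, d x y = d y x,
        forall y x z, d x z <= d x y + d y z &
        forall x, nbhs x =
          filter_from [set e | 0 < e] (fun e => [set y | d x y < e])].

Lemma metricType_metrizable (M : metricType R) : metrizable M.
Proof.
exists (@mdist R M); split.
- by move=> x y; split=> [/mdist_positivity//|->]; exact: mdistxx.
- exact: metric_sym.
- by move=> y x z; exact: metric_triangle.
- move=> x; rewrite -nbhs_ballE; apply/seteqP; split=> A [e e0 eA];
    by exists e => //; move: eA; rewrite ballEmdist.
Qed.

End Metrizable.

Section UnitInterval.
Context (R : realType).

Definition unit_interval : set R := `[0, 1]%classic.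

Lemma unit_interval0 : (0 : R) \in unit_interval.
Proof. by rewrite inE /unit_interval /= in_itv /= lexx ler01. Qed.

Lemma unit_interval1 : (1 : R) \in unit_interval.
Proof. by rewrite inE /unit_interval /= in_itv /= lexx ler01. Qed.

Definition I0 : unit_interval := SigSub unit_interval0.
Definition I1 : unit_interval := SigSub unit_interval1.

End UnitInterval.
Arguments unit_interval : clear implicits.
Arguments I0 : clear implicits.
Arguments I1 : clear implicits.

Section OpenCovers.
Context {X Y : topologicalType}.

Definition open_cover (U : set (set Y)) :=
  (forall V, U V -> open V) /\ \bigcup_(V in U) V = setT.

Definition preimage_cover (f : X -> Y) (U : set (set Y)) : set (set X) :=
  [set f @^-1` V | V in U].

End OpenCovers.

Section GMaps.
Context {G : topologicalGroupType}.
Implicit Types X Y Z : gSpaceType G.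

Definition G_map X Y (f : X -> Y) :=
  continuous f /\ forall (g : G) x, f (gact g x) = gact g (f x).

Definition invariant_set X (S : set X) :=
  forall (g : G) x, S x -> S (gact g x).

(* A topological embedding: Y carries the topology induced by i. *)
Definition closed_G_embedding Y Z (i : Y -> Z) :=
  [/\ G_map i, injective i,
      forall A : set Y, open A <-> exists2 B : set Z, open B & A = i @^-1` B &
      closed (range i)].

(* Y is identified with range i. The domain of r is the subtype of Z
   determined by U, so that r exists when both U and Y are empty; the hypothesis on u and v
   says v = g u in Z, where g u is again in U as soon as U is invariant. *)
Definition G_retraction Y Z (i : Y -> Z) (U : set Z) (r : U -> Y) :=
  [/\ continuous r,
      forall (g : G) (u v : U),
        set_val v = gact g (set_val u) -> r v = gact g (r u) &
      forall (y : Y) (u : U), set_val u = i y -> r u = y].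

Definition G_ANR (R : realType) Y :=
  metrizable R Y /\
  forall Z (i : Y -> Z), metrizable R Z -> closed_G_embedding i ->
    exists U : set Z,
      [/\ invariant_set U, set_nbhs (range i) U &
          exists r : U -> Y, G_retraction i r].

Definition G_homotopy (R : realType) X Y (F : X * unit_interval R -> Y) :=
  continuous F /\
  forall (g : G) x t, F (gact g x, t) = gact g (F (x, t)).

Definition G_cover_homotopy (R : realType) X Y (U : set (set Y))
    (F : X * unit_interval R -> Y) :=
  G_homotopy F /\
  forall x, exists2 V, U V & forall t, V (F (x, t)).

Definition G_cover_homotopic (R : realType) X Y (U : set (set Y))
    (f0 f1 : X -> Y) :=
  exists F : X * unit_interval R -> Y,
    [/\ G_cover_homotopy U F,
        forall x, F (x, I0 R) = f0 x & forall x, F (x, I1 R) = f1 x].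

Definition fine_G_homotopy_equivalence (R : realType) X Y (f : X -> Y) :=
  G_map f /\
  forall U : set (set Y), open_cover U ->
    exists phi : Y -> X,
      [/\ G_map phi,
          G_cover_homotopic R (preimage_cover f U) (phi \o f) idfun &
          G_cover_homotopic R U (f \o phi) idfun].

End GMaps.

(* Main.v *)
Require Import Defs.
From HB Require Import structures.
From mathcomp Require Import all_boot all_order all_algebra.
From mathcomp Require Import all_classical all_reals all_analysis.
From mathcomp Require Import lra ring zify.

(**
Fix an invariant metric on each space.  The ambient space of X is the set of
pairs (h, s) with h in l_oo(X), s >= 0 and h = d(x, -) for some x when s = 0; it
contains X as the closed set s = 0, so the ANR property gives an equivariant
retraction of a neighborhood of X onto X.  Hausdorff's explicit formula for
Tietze extension (an infimum, hence equivariant, so that no Haar integral is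
needed) maps Z into the ambient space whenever a G-map into X is given on a
closed invariant subset; hence X is an equivariant neighborhood extensor.
Straight segments, lifted to s > 0 in their interior, show that X is
equivariantly locally equiconnected.

Given Y closed in Z, choose left homotopy inverses phi_n of f with control 2^-n
and extend them to maps Phi_n near Y.  In X the map Phi_n is joined to
phi_n f Phi_(n+1) by a short path if phi_(n+1) is chosen fine enough with
respect to phi_n, and phi_n f Phi_(n+1) is joined to Phi_(n+1) by the given
homotopy phi_n f ~ id.  The f-images of these homotopies, run at a speed that
reaches n = oo exactly on Y, form a retraction of a neighborhood of Y.  So Y is
a G-ANR, and f phi, being close to the identity on the dense set f(X), is
homotopic to the identity by local equiconnectedness of Y.
*)

Set Implicit Arguments.
Unset Strict Implicit.
Unset Printing Implicit Defensive.

Import Order.TTheory GRing.Theory Num.Theory numFieldNormedType.Exports.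

Local Open Scope classical_set_scope.
Local Open Scope ring_scope.

(** * Compatible and invariant metrics *)

Section CompatibleMetric.
Context {R : realType}.

(** The clauses under the existential in [metrizable], so that a witness of [metrizable] is directly
    a compatible metric. *)
Definition compatible_metric (T : topologicalType) (d : T -> T -> R) :=
  [/\ forall x y, d x y = 0 <-> x = y,
      forall x y, d x y = d y x,
      forall y x z, d x z <= d x y + d y z &
      forall x, nbhs x =
        filter_from [set e | 0 < e] (fun e => [set y | d x y < e])].

Context {T : topologicalType} {d : T -> T -> R}.
Hypothesis dP : compatible_metric d.

Lemma cm_xx x : d x x = 0.
Proof. by case: dP => h _ _ _; apply/h. Qed.

Lemma cm_eq x y : d x y = 0 -> x = y.
Proof. by case: dP => h _ _ _ /h. Qed.

Lemma cm_sym x y : d x y = d y x.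
Proof. by case: dP. Qed.

Lemma cm_tri y x z : d x z <= d x y + d y z.
Proof. by case: dP. Qed.

Lemma cm_ge0 x y : 0 <= d x y.
Proof.
by have := cm_tri y x x; rewrite cm_xx (cm_sym y x) -mulr2n pmulrn_lge0.
Qed.

Lemma cm_nbhsP x (A : set T) :
  nbhs x A <-> exists2 e, 0 < e & forall y, d x y < e -> A y.
Proof. by case: dP => _ _ _ ->; split=> -[e e0 eA]; exists e. Qed.

Lemma cm_near x e : 0 < e -> \forall y \near x, d x y < e.
Proof. by move=> e0; apply/cm_nbhsP; exists e. Qed.

Lemma cm_cvg {U : Type} (F : set_system U) {FF : Filter F} (h : U -> T) x :
  h @ F --> x <-> forall e, 0 < e -> \forall u \near F, d x (h u) < e.
Proof.
split=> [hx e e0|hF A /cm_nbhsP[e e0 eA]]; first exact: hx (cm_near x e0).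
by near=> u; apply: eA; near: u; exact: hF.
Unshelve. all: by end_near. Qed.

Lemma cm_lip x y x' y' : `|d x y - d x' y'| <= d x x' + d y y'.
Proof.
have := cm_tri x' x y; have := cm_tri y' x' y; have := cm_tri x x' y'.
have := cm_tri y x y'; rewrite (cm_sym x' x) (cm_sym y' y) => *.
by rewrite ler_norml; apply/andP; split; lra.
Qed.

Lemma cm_cvg2 {U : Type} (F : set_system U) {FF : Filter F} (h k : U -> T) x y :
  h @ F --> x -> k @ F --> y -> (fun u => d (h u) (k u)) @ F --> d x y.
Proof.
move=> /cm_cvg hx /cm_cvg ky; apply/cvgrPdist_lt => e e0; near=> u.
apply: le_lt_trans (cm_lip _ _ _ _) _; rewrite [e]splitr ltrD//; near: u.
  by apply: hx; rewrite divr_gt0.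
by apply: ky; rewrite divr_gt0.
Unshelve. all: by end_near. Qed.

End CompatibleMetric.

Section CappedInfimum.
Context {R : realType}.
Implicit Types A B : set R.

(* Capping at 1 makes the infimum of the empty set harmless. *)
Definition capped_inf A : R := inf ([set 1] `|` A).

Definition nonneg A := forall r, A r -> 0 <= r.

Lemma capped_inf_ge A v :
  v <= 1 -> (forall r, A r -> v <= r) -> v <= capped_inf A.
Proof.
move=> v1 vA; apply: lb_le_inf; first by exists 1; left.
by move=> r [->//|]; exact: vA.
Qed.

Lemma capped_inf_ge0 A : nonneg A -> 0 <= capped_inf A.
Proof. by move=> A0; exact: capped_inf_ge. Qed.

Let lbA A : nonneg A -> has_lbound ([set 1] `|` A).
Proof. by move=> A0; exists 0 => r [->//|/A0]. Qed.

Lemma capped_inf_le1 A : nonneg A -> capped_inf A <= 1.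
Proof. by move=> /lbA/ge_inf; apply; left. Qed.

Lemma capped_inf_le A r : nonneg A -> A r -> capped_inf A <= r.
Proof. by move=> /lbA/ge_inf h Ar; apply: h; right. Qed.

Lemma capped_inf_lt A v : capped_inf A < v -> v <= 1 ->
  exists2 r, A r & r < v.
Proof.
move=> Av v1; apply: contrapT => h; move: Av; apply/negP; rewrite -leNgt.
apply: capped_inf_ge => // r Ar; rewrite leNgt; apply/negP => rv.
by apply: h; exists r.
Qed.

(** Termwise estimates pass to infima. Used in both directions, this gives the continuity of
    [dist_to] and of Hausdorff's formula. *)
Lemma capped_inf_leD A B e : nonneg A -> 0 <= e ->
  (forall r, B r -> exists2 r', A r' & r' <= r + e) ->
  capped_inf A <= capped_inf B + e.
Proof.
move=> A0 e0 AB; rewrite -lerBlDr; apply: capped_inf_ge.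
  by rewrite lerBlDr (le_trans (capped_inf_le1 A0))// lerDl.
move=> r /AB[r' Ar' r'r]; rewrite lerBlDr; apply: le_trans r'r.
exact: capped_inf_le.
Qed.

End CappedInfimum.

Section InvariantMetric.
Context {R : realType} {G : topologicalGroupType}.
Hypothesis G_compact : compact [set: G].

(** The tube lemma, used with [G] and with [0, 1] as the compact factor. *)
Lemma near_compact {K A : topologicalType} (C : set K) (P : K -> A -> Prop) (a :
  A) :
  compact C -> (forall k, C k -> \forall p \near (k, a), P p.1 p.2) ->
  \forall b \near a, forall k, C k -> P k b.
Proof.
move=> /compact_near_coveringP cC kP.
exact: (cC A (@nbhs A A a) (fun b k => P k b) _ kP).
Qed.

Lemma gact_cvg (X : gSpaceType G) {U : Type} (F : set_system U) {FF : Filter F}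
    (h : U -> G) (k : U -> X) g x :
  h @ F --> g -> k @ F --> x -> (fun u => gact (h u) (k u)) @ F --> gact g x.
Proof.
move=> hg kx.
apply: (@cvg_comp _ _ _ (fun u => (h u, k u)) (fun p : G * X => gact p.1 p.2)
  _ (nbhs (g, x))); first exact: cvg_pair.
exact: (@gact_continuous G X (g, x)).
Qed.

Definition invariant_metric (X : gSpaceType G) (d : X -> X -> R) :=
  [/\ compatible_metric d, forall g x y, d (gact g x) (gact g y) = d x y &
      forall x y, d x y <= 1].

(** Truncate a metric [d0] at 1 and take the supremum of its translates under the group. The tube
    lemma over the compact [G] shows that points [d0]-close to [x] remain close to it after all
    translations at once, so the topology does not change. *)
Lemma exists_invariant_metric (X : gSpaceType G) :
  metrizable R X -> exists d : X -> X -> R, invariant_metric d.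
Proof.
move=> [d0 d0P]; have {}d0P : compatible_metric d0 by [].
pose m (x y : X) g := Num.min 1 (d0 (gact g x) (gact g y)).
pose d x y := sup (range (m x y)).
have m0 x y g : 0 <= m x y g by rewrite le_min ler01 (cm_ge0 d0P).
have m1 x y g : m x y g <= 1 by rewrite ge_min lexx.
have ub x y : has_ubound (range (m x y)) by exists 1 => _ [g _ <-].
have md x y g : m x y g <= d x y by apply: ub_le_sup => //; exists g.
have dm x y e : (forall g, m x y g <= e) -> d x y <= e.
  by move=> h; apply: ge_sup; [exists (m x y 1%g), 1%g|move=> _ [g _ <-]].
have mxx x g : m x x g = 0 by rewrite /m (cm_xx d0P); apply/min_idPr; exact:
  ler01.
exists d; split; last by move=> x y; exact: dm.
- split.
  + move=> x y; split=> [dxy|->]; last first.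
      apply/eqP; rewrite eq_le; apply/andP; split.
        by apply: dm => g; rewrite mxx.
      by apply: le_trans (md y y 1%g); rewrite mxx.
    have := md x y 1%g; rewrite dxy /m !gact1 ge_min leNgt ltr01 /= => dxy0.
    by apply: (cm_eq d0P); apply: le_anti; rewrite dxy0 (cm_ge0 d0P).
  + move=> x y; rewrite /d; suff -> : m x y = m y x by [].
    by apply/funext => g; rewrite /m (cm_sym d0P).
  + move=> y x z; apply: dm => g; apply: le_trans (lerD (md x y g) (md y z g)).
    have := cm_tri d0P (gact g y) (gact g x) (gact g z).
    have := cm_ge0 d0P (gact g x) (gact g y).
    have := cm_ge0 d0P (gact g y) (gact g z).
    rewrite /m /Num.min; do 3 case: ltP => ?; lra.
  + move=> x; apply/seteqP; split=> A.
      move=> /(cm_nbhsP d0P)[e e0 eA]; exists (Num.min e 1) => /=.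
        by rewrite lt_min e0 ltr01.
      move=> y /= yA; apply: eA; have := le_lt_trans (md x y 1%g) yA.
      rewrite /m !gact1 lt_min !gt_min ltxx => /andP[/orP[e1 h|//]]; exact:
        lt_trans e1.

    move=> [e /= e0 eA].
    have : \forall y \near x, forall g, [set: G] g ->
        d0 (gact g x) (gact g y) < e / 2.
      apply: near_compact => // g _ /=.
      have /cvgrPdist_lt/(_ (e/2)) : (fun p : G * X => d0 (gact p.1 x) (gact p.1
        p.2))
         @ (g, x) --> d0 (gact g x) (gact g x).
        apply: (cm_cvg2 d0P).
          apply: gact_cvg; [exact: cvg_fst|exact: cvg_cst].
        apply: gact_cvg; [exact: cvg_fst|exact: cvg_snd].
      rewrite divr_gt0// => /(_ isT); apply: filterS => p /=.
      by rewrite (cm_xx d0P) sub0r normrN ger0_norm// (cm_ge0 d0P).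
    apply: filterS => y h; apply: eA => /=.
    apply: (@le_lt_trans _ _ (e/2)); last by rewrite ltr_pdivrMr// ltr_pMr//
      ltr1n.
    by apply: dm => g; rewrite ge_min; apply/orP; right; apply/ltW; exact: h.
- move=> h x y; apply/eqP; rewrite eq_le; apply/andP; split; apply: dm => g.
    have <- : m x y (g * h)%g = m (gact h x) (gact h y) g by rewrite /m !gactM.
    exact: md.
  have <- : m (gact h x) (gact h y) (g * h^-1)%g = m x y g.
    by rewrite /m -!gactM -mulgA mulVg mulg1.
  exact: md.
Qed.

End InvariantMetric.

(** * The ambient space of a metric G-space *)

Section IsometricAction.
Context {R : realType} {G : topologicalGroupType} (S : Type).
Variables (d : S -> S -> R) (act : G -> S -> S).
Hypothesis d_eq : forall x y, d x y = 0 <-> x = y.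
Hypothesis d_sym : forall x y, d x y = d y x.
Hypothesis d_tri : forall y x z, d x z <= d x y + d y z.
Hypothesis act1 : forall x, act 1%g x = x.
Hypothesis actM : forall g h x, act (g * h)%g x = act g (act h x).
Hypothesis act_isometry : forall g x y, d (act g x) (act g y) = d x y.
Hypothesis orbit_continuous : forall x e, 0 < e ->
  \forall g \near (1%g : G), d x (act g x) < e.

(** For an isometric action, d(gx, hy) <= d(x, g^-1 h x) + d(x, y), so continuity of the orbit maps
    at 1 already gives joint continuity. The structures are put on [S] inside the proof; the
    mutually inverse [i] and [k] transport them to the outside. *)
Lemma isometric_gSpace :
  exists (T : gSpaceType G) (i : S -> T) (k : T -> S),
    [/\ cancel i k, cancel k i,
        forall g x, gact g (i x) = i (act g x) &
        compatible_metric (fun a b : T => d (k a) (k b))].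
Proof.
have d0 x : d x x = 0 by apply/d_eq.
pose N (x : S) : set_system S :=
  filter_from [set e | 0 < e] (fun e => [set y | d x y < e]).
pose C : choiceType := HB.pack_for choiceType S
  (gen_eqMixin S) (gen_choiceMixin S).
pose B : nbhsType := HB.pack_for nbhsType C (hasNbhs.Build C N).
have N1 (p : B) : ProperFilter (nbhs p).
  apply: filter_from_proper; last by move=> e /= e0; exists p; rewrite /= d0.
  apply: filter_from_filter; first by exists 1 => /=.
  move=> e e' /= e0 e'0; exists (Num.min e e') => /=.
    by rewrite lt_min e0.
  by move=> y /=; rewrite lt_min => /andP[].
have N2 (p : B) (A : set B) : nbhs p A -> A p.
  by move=> [e /= e0]; apply; rewrite /= d0.
have N3 (p : B) (A : set B) : nbhs p A -> nbhs p (nbhs^~ A).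
  move=> [e /= e0 eA]; exists (e / 2) => /=; first by rewrite divr_gt0.
  move=> y /= py; exists (e / 2) => /=; first by rewrite divr_gt0.
  by move=> z /= yz; apply: eA => /=; apply: le_lt_trans (d_tri y p z) _; lra.
pose T0 : topologicalType := HB.pack_for topologicalType B
  (Nbhs_isNbhsTopological.Build B N1 N2 N3).
have dP : compatible_metric (d : T0 -> T0 -> R) by split.
have cact : continuous (fun p : G * T0 => act p.1 p.2 : T0).
  move=> -[g x]; apply/(cm_cvg dP) => e e0 /=.
  have e20 : 0 < e / 2 by rewrite divr_gt0.
  have h1 : \forall p \near (g, x : T0), d x (act (g^-1 * p.1)%g x) < e / 2.
    have c : (g^-1 * p.1)%g @[p --> (g, x : T0)] --> (1%g : G).
      rewrite -(mulVg g).
      apply: (@cvg_comp _ _ _ (fun p : G * T0 => (g^-1%g, p.1))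
        (fun p : G * G => (p.1 * p.2)%g) _ (nbhs (g^-1%g, g))).
        by apply: cvg_pair; [exact: cvg_cst|exact: cvg_fst].
      exact: (mulg_continuous (g^-1%g, g)).
    exact: c (orbit_continuous x e20).
  have h2 : \forall p \near (g, x : T0), d x p.2 < e / 2.
    have c : p.2 @[p --> (g, x : T0)] --> x by exact: cvg_snd.
    exact: c (cm_near dP x e20).
  near=> p; apply: le_lt_trans (d_tri (act p.1 x) _ _) _.
  rewrite act_isometry -(act_isometry g^-1%g) -!actM mulVg act1 [e]splitr.
  by apply: ltrD; near: p.
pose T : gSpaceType G := HB.pack_for (gSpaceType G) T0
  (isGSpace.Build G T0 act1 actM cact).
by exists T, id, id.
Unshelve. all: by end_near. Qed.
End IsometricAction.

Section SupDistance.
Context {R : realType} {X : Type} (x0 : X).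
Implicit Types h : X -> R.

Definition unit_valued h := forall x, 0 <= h x <= 1.

Definition sup_dist h h' := sup (range (fun x => `|h x - h' x|)).

Lemma le_sup_dist h h' x :
  unit_valued h -> unit_valued h' -> `| h x - h' x | <= sup_dist h h'.
Proof.
move=> h1 h'1; apply: ub_le_sup; last by exists x.
exists 1 => _ [y _ <-]; have := h1 y; have := h'1 y.
by rewrite ler_norml => /andP[? ?] /andP[? ?]; apply/andP; split; lra.
Qed.

Lemma sup_dist_le h h' e : (forall x, `|h x - h' x| <= e) -> sup_dist h h' <= e.
Proof.
move=> he; apply: ge_sup; first by exists `|h x0 - h' x0|, x0.
by move=> _ [x _ <-].
Qed.

End SupDistance.

Section Ambient.
Context {R : realType} {G : topologicalGroupType}.
Context {X : gSpaceType G} (d : X -> X -> R) (x0 : X).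
Hypothesis dP : invariant_metric d.

Let cP : compatible_metric d. Proof. by case: dP. Qed.
Let d_inv g x y : d (gact g x) (gact g y) = d x y. Proof. by case: dP. Qed.

Let d_inv' g x y : d x (gact g^-1%g y) = d (gact g x) y.
Proof. by rewrite -(d_inv g) -gactM mulgV gact1. Qed.

(* X need not be closed in l_oo(X): the coordinate p.2 makes it closed. *)
Definition ambient_point (p : (X -> R) * R) :=
  [/\ unit_valued p.1, 0 <= p.2, p.2 = 0 -> exists x, p.1 = d x &
      forall e, 0 < e -> \forall g \near (1%g : G),
        forall x, `|p.1 x - p.1 (gact g^-1%g x)| < e].

Definition ambient := {p | ambient_point p}.

Definition ambient_dist (p q : ambient) : R :=
  sup_dist (sval p).1 (sval q).1 + `|(sval p).2 - (sval q).2|.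

Let ambient_unit (p : ambient) : unit_valued (sval p).1.
Proof. by case: (svalP p). Qed.

Lemma ambient_act_subproof g (p : ambient) :
  ambient_point ((sval p).1 \o gact g^-1%g, (sval p).2).
Proof.
case: (svalP p) => p1 p2 p0 pc; split => //=.
- by move=> x; exact: p1.
- move=> /p0[x ->]; exists (gact g x); apply/funext => y /=.
  exact: d_inv'.
- move=> e e0.
  (* Moving the translate of [p] by [g] with [h] amounts to moving [p] with the conjugate g^-1 h g,
     which tends to 1 with [h]. *)
  have c : (g^-1 * h * g)%g @[h --> (1%g : G)] --> (1%g : G).
    have e1 : (1%g : G) = (g^-1 * 1 * g)%g by rewrite mulg1 mulVg.
    rewrite [X in _ --> X]e1.
    apply: (@cvg_comp _ _ _ (fun h : G => ((g^-1 * h)%g, g))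
        (fun p : G * G => (p.1 * p.2)%g) _ (nbhs ((g^-1 * 1)%g, g))); last
          first.
      exact: (mulg_continuous ((g^-1 * 1)%g, g)).
    apply: cvg_pair; last exact: cvg_cst.
    apply: (@cvg_comp _ _ _ (fun h : G => (g^-1%g, h))
        (fun p : G * G => (p.1 * p.2)%g) _ (nbhs (g^-1%g, 1%g))); last first.
      exact: (mulg_continuous (g^-1%g, 1%g)).
    by apply: cvg_pair; [exact: cvg_cst|exact: cvg_id].
  have : \forall h \near (1%g : G), forall x,
      `|(sval p).1 x - (sval p).1 (gact (g^-1 * h * g)^-1%g x)| < e.
    exact: c (pc e e0).
  apply: filterS => h hx x.
  have := hx (gact g^-1%g x).
  by rewrite -!gactM !invgM invgK -!mulgA mulgV mulg1.
Qed.

Definition ambient_act g p : ambient := exist _ _ (ambient_act_subproof g p).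

Lemma ambient_eq (p q : ambient) :
  (sval p).1 = (sval q).1 -> (sval p).2 = (sval q).2 -> p = q.
Proof.
case: p q => [[h s] hs] [[h' s'] hs'] /= hh' ss'.
by apply: eq_exist => /=; rewrite hh' ss'.
Qed.

Lemma le_ambient_dist p q x :
  `|(sval p).1 x - (sval q).1 x| <= ambient_dist p q.
Proof.
apply: le_trans (le_sup_dist x (ambient_unit p) (ambient_unit q)) _.
by rewrite lerDl.
Qed.

(** Translation is isometric for the supremum distance but need not have continuous orbit maps on
    all of l_oo(X); the last clause of [ambient_point] selects the functions for which it does. *)
Lemma ambient_space : exists (T : gSpaceType G) (i : ambient -> T)
    (k : T -> ambient),
  [/\ cancel i k, cancel k i,
      forall g p, gact g (i p) = i (ambient_act g p) &
      compatible_metric (fun a b : T => ambient_dist (k a) (k b))].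
Proof.
apply: isometric_gSpace.
- move=> p q; split=> [pq|->]; last first.
    rewrite /ambient_dist subrr normr0 addr0; apply/eqP; rewrite eq_le.
    rewrite (sup_dist_le x0) => [|x]; last by rewrite subrr normr0.
    apply: le_trans (le_sup_dist x0 (ambient_unit q) (ambient_unit q)).
    by rewrite normr_ge0.
  apply: ambient_eq.
    apply/funext => x; apply/eqP; rewrite -subr_eq0 -normr_le0.
    by have := le_ambient_dist p q x; rewrite pq.
  apply/eqP; rewrite -subr_eq0 -normr_le0 -pq lerDr.
  by apply: le_trans (le_sup_dist x0 (ambient_unit _) (ambient_unit _)).
- move=> p q; rewrite /ambient_dist distrC; congr (_ + _).
  rewrite /sup_dist; suff -> : (fun x => `|(sval p).1 x - (sval q).1 x|) =
    (fun x => `|(sval q).1 x - (sval p).1 x|) by [].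
  by apply/funext => x; rewrite distrC.
- move=> q p r; rewrite /ambient_dist addrACA lerD ?ler_distD//.
  apply: (sup_dist_le x0) => x; apply: le_trans (ler_distD ((sval q).1 x) _ _)
    _.
  by apply: lerD; exact: le_sup_dist.
- by move=> p; apply: ambient_eq => //=; apply/funext => x /=; rewrite invg1
    gact1.
- by move=> g h p; apply: ambient_eq => //=; apply/funext => x /=;
    rewrite invgM gactM.
- move=> g p q; rewrite /ambient_dist /=; congr (_ + _).
  apply/eqP; rewrite eq_le; apply/andP; split; apply: (sup_dist_le x0) => x.
    exact: (le_sup_dist (gact g^-1%g x) (ambient_unit p) (ambient_unit q)).
  have /= := le_sup_dist (gact g x) (ambient_unit (ambient_act g p))
    (ambient_unit (ambient_act g q)).
  by rewrite -!gactM mulVg gact1.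
- move=> p e e0; case: (svalP p) => _ _ _ /(_ (e / 2)).
  rewrite divr_gt0// => /(_ isT); apply: filterS => g h.
  rewrite /ambient_dist /= subrr normr0 addr0.
  apply: (@le_lt_trans _ _ (e / 2)); last lra.
  by apply: (sup_dist_le x0) => x; apply/ltW/h.
Qed.

End Ambient.

Lemma isometry_inducing {R : realType} {S T : topologicalType}
    (dS : S -> S -> R) (dT : T -> T -> R) (i : S -> T) :
  compatible_metric dS -> compatible_metric dT ->
  (forall x y, dT (i x) (i y) = dS x y) ->
  continuous i /\
  forall A : set S, open A <-> exists2 B : set T, open B & A = i @^-1` B.
Proof.
move=> SP TP iso.
have ic : continuous i.
  move=> x; apply/(cm_cvg TP) => e e0; apply: filterS (cm_near SP x e0) => y.
  by rewrite iso.
split=> // A; split=> [oA|[B oB ->]]; last by apply: open_comp => // x _; exact: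
  ic.
(* The largest open set missing the image of the complement of [A]. A ball around [x] inside [A]
   keeps [i x] away from that image, by isometry. *)
exists (~` closure (i @` (~` A))).
  by rewrite openC; exact: closed_closure.
apply/seteqP; split=> x /=.
  move=> Ax cx; have /(cm_nbhsP SP)[e e0 eA] : nbhs x A by exact:
    open_nbhs_nbhs.
  have [_ [[y Ay <-] /=]] := cx _ (cm_near TP (i x) e0).
  by rewrite iso => /eA.
move=> cx; apply: contrapT => Ax; apply: cx; apply: subset_closure.
by exists x.
Qed.

(** Lets the invariant neighborhoods given by the ANR property be replaced by open ones. *)
Lemma interior_invariant {G : topologicalGroupType} (Z : gSpaceType G)
  (U : set Z) : invariant_set U -> invariant_set U^°.
Proof.
move=> Ui g z Uz.
have c : (fun y : Z => gact g^-1%g y) @ gact g z --> z.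
  rewrite -[X in _ --> X]gact1 -(mulVg g) gactM.
  by apply: gact_cvg; [exact: cvg_cst|exact: cvg_id].
have : \forall y \near gact g z, U (gact g^-1%g y) by exact: c Uz.
apply: filterS => y /= /(Ui g).
by rewrite -gactM mulgV gact1.
Qed.

(* rho takes the junk value x0 off U. *)
Lemma total_retraction {G : topologicalGroupType} (X Z : gSpaceType G)
    (i : X -> Z) (x0 : X) (U : set Z) (r : U -> X) :
  invariant_set U -> set_nbhs (range i) U -> G_retraction i r ->
  exists (O : set Z) (rho : Z -> X),
    [/\ open O, invariant_set O & forall x, O (i x)] /\
    [/\ forall z, O z -> rho y @[y --> z] --> rho z,
        forall g z, O z -> rho (gact g z) = gact g (rho z) &
        forall x, rho (i x) = x].
Proof.
move=> Ui Un [rc rG ri].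
pose rho z := if pselect (U z) is left h then r (SigSub (mem_set h)) else x0.
have rhoE z (h : z \in U) : rho z = r (SigSub h).
  rewrite /rho; case: pselect => [h'|]; last by have := set_mem h.
  by congr r; apply: val_inj.
exists U^°, rho; split; split.
- exact: open_interior.
- exact: interior_invariant.
- by move=> x; apply: Un; exists x.
- move=> z Oz W.
  have Uz := mem_set (interior_subset Oz).
  rewrite (rhoE _ Uz) => /(rc (SigSub Uz)) [B [[C oC CB] Bz BW]].
  have nC : nbhs z C.
    by apply: open_nbhs_nbhs; split=> //; move: Bz; rewrite -CB.
  apply: filterS2 Oz nC => y /mem_set Uy Cy.
  rewrite /= (rhoE _ Uy); apply: (BW (SigSub Uy)).
  by rewrite -CB.
- move=> g z Oz; have Uz := mem_set (interior_subset Oz).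
  have Ugz : gact g z \in U by apply/mem_set/Ui/set_mem.
  by rewrite (rhoE _ Uz) (rhoE _ Ugz); apply: rG.
- move=> x; have Ux : i x \in U.
    have h : nbhs (i x) U by apply: Un; exists x.
    exact: mem_set (nbhs_singleton h).
  by rewrite (rhoE _ Ux); exact: ri.
Qed.

(** * Maps into a G-ANR through its ambient space *)

Section AmbientExtension.
Context {R : realType} {G : topologicalGroupType}.
Context {X : gSpaceType G} (d : X -> X -> R) (x0 : X).
Hypothesis dP : invariant_metric d.
Hypothesis X_ANR : G_ANR R X.

Let cP : compatible_metric d. Proof. by case: dP. Qed.
Let d_inv g x y : d (gact g x) (gact g y) = d x y. Proof. by case: dP. Qed.
Let d1 x y : d x y <= 1. Proof. by case: dP. Qed.
Let d_inv' g x y : d x (gact g^-1%g y) = d (gact g x) y.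
Proof. by rewrite -(d_inv g) -gactM mulgV gact1. Qed.

Lemma dist_unit_valued x : unit_valued (d x).
Proof. by move=> y; rewrite (cm_ge0 cP) d1. Qed.

(** The Kuratowski embedding of [X], placed at height 0. *)
Lemma dist_ambient x : ambient_point d (d x, 0).
Proof.
split => //=; first exact: dist_unit_valued.
  by move=> _; exists x.
move=> e e0.
have c : gact g x @[g --> (1%g : G)] --> x.
  rewrite -[X in _ --> X]gact1.
  by apply: gact_cvg; [exact: cvg_id|exact: cvg_cst].
have : \forall g \near (1%g : G), d x (gact g x) < e by exact: c (cm_near cP _
  e0).
apply: filterS => g h y; rewrite d_inv'.
by apply: le_lt_trans (cm_lip cP _ _ _ _) _; rewrite (cm_xx cP) addr0.
Qed.

(** The map a |-> (h a, s a) into the ambient space is followed by the retraction onto [X]. The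
    action on [A] is a bare function whose orbit maps are continuous at 1, so that products such as
    [X * X * R] can serve as [A] without a G-space structure. This lemma is the only access to the
    ANR property of [X] below. *)
Lemma ambient_extension (A : topologicalType) (act : G -> A -> A)
    (h : A -> X -> R) (s : A -> R) :
  (forall a, act g a @[g --> (1%g : G)] --> a) ->
  (forall a, unit_valued (h a)) -> (forall a, 0 <= s a) ->
  (forall a, s a = 0 -> exists x, h a = d x) ->
  (forall g a x, h (act g a) x = h a (gact g^-1%g x)) ->
  (forall g a, s (act g a) = s a) ->
  (forall a e, 0 < e -> \forall b \near a, forall x, `|h a x - h b x| < e) ->
  continuous s ->
  exists (O : set A) (Phi : A -> X),
    [/\ open O, forall g a, O a -> O (act g a),
        forall a, O a -> Phi b @[b --> a] --> Phi a,
        forall g a, O a -> Phi (act g a) = gact g (Phi a) &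
        forall a x, s a = 0 -> h a = d x -> O a /\ Phi a = x].
Proof.
move=> acta h1 s0 hs0 hG sG hc sc.
have [T [i [k [ik ki iG TP]]]] := ambient_space x0 dP.
have [U [Ui Un [r rP]]] : exists U : set T,
    [/\ invariant_set U,
        set_nbhs (range (fun x => i (exist _ _ (dist_ambient x)))) U &
        exists r : U -> X,
          G_retraction (fun x => i (exist _ _ (dist_ambient x))) r].
  case: X_ANR => _; apply; first by exists (fun a b => ambient_dist (k a) (k
    b)).
  have iso x y : ambient_dist (k (i (exist _ _ (dist_ambient x))))
      (k (i (exist _ _ (dist_ambient y)))) = d x y.
    rewrite !ik /ambient_dist /= subrr normr0 addr0; apply: le_anti.
    apply/andP; split.
      apply: (sup_dist_le x0) => z; apply: le_trans (cm_lip cP _ _ _ _) _.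
      by rewrite (cm_xx cP) addr0.
    have := le_sup_dist y (dist_unit_valued x) (dist_unit_valued y).
    by rewrite (cm_xx cP) subr0 ger0_norm// (cm_ge0 cP).
  have [ic iO] := isometry_inducing cP TP iso.
  split => //.
  - split => // g x; rewrite iG; congr i; apply: ambient_eq => //=.
    by apply/funext => y; rewrite /= d_inv'.
  - move=> x y xy; apply: (cm_eq cP); rewrite -iso xy.
    exact: (cm_xx TP).
  - move=> t ct.
    (* Heights differ by at most the distance, so a limit of points at height 0 has height 0, and
       [ambient_point] then makes it a point of [X]. *)
    have t0 : (sval (k t)).2 = 0.
      apply/eqP; rewrite -normr_le0 leNgt; apply/negP => t0.
      have [_ [[x _ <-] /=]] := ct _ (cm_near TP t t0).
      rewrite ik /ambient_dist /= subr0.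
      case: (svalP (k t)) => kt _ _ _.
      have := le_sup_dist x0 kt (dist_unit_valued x).
      have := normr_ge0 ((sval (k t)).1 x0 - d x x0); lra.
    case: (svalP (k t)) => _ _ /(_ t0) [x kx] _.
    exists x => //; apply: (can_inj ki); rewrite ik.
    by apply: ambient_eq => /=; rewrite ?kx ?t0.
have [V [rho [[oV Vi iV] [rhoc rhoG rhoi]]]] := total_retraction x0 Ui Un rP.
have mP a : ambient_point d (h a, s a).
  split => //= [|e e0]; first exact: hs0.
  have : \forall g \near (1%g : G), forall x, `|h a x - h (act g a) x| < e.
    exact: acta (hc a e e0).
  by apply: filterS => g + x => /(_ x); rewrite hG.
pose m a := i (exist _ _ (mP a)).
have mc : continuous m.
  move=> a; apply/(cm_cvg TP) => e e0; rewrite /m.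
  have e20 : 0 < e / 2 by rewrite divr_gt0.
  have /cvgrPdist_lt/(_ _ e20) sa : s b @[b --> a] --> s a by exact: sc.
  near=> b; rewrite !ik /ambient_dist /= [e]splitr ler_ltD //; last first.
    by near: b.
  apply: (sup_dist_le x0) => x; apply/ltW; move: x; near: b.
  exact: hc.
have mG g a : m (act g a) = gact g (m a).
  rewrite iG; congr i; apply: ambient_eq => /=; last by rewrite sG.
  by apply/funext => x; rewrite /= hG.
exists (m @^-1` V), (rho \o m); split.
- by apply: open_comp => // a _; exact: mc.
- by move=> g a /= Va; rewrite mG; exact: Vi.
- move=> a Va; apply: continuous_comp; first exact: mc.
  exact: rhoc.
- by move=> g a Va /=; rewrite mG rhoG.
- move=> a x sa ha /=; have -> : m a = i (exist _ _ (dist_ambient x)).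
    by congr i; apply: ambient_eq.
  by split.
Unshelve. all: by end_near. Qed.

End AmbientExtension.

(** * Equivariant neighborhood extension *)

Section DistanceToSet.
Context {R : realType} {T : topologicalType} {d : T -> T -> R}.
Hypothesis dP : compatible_metric d.
Implicit Types B : set T.

Definition dist_to B z := capped_inf [set d z b | b in B].

Let nonneg_dist B z : nonneg [set d z b | b in B].
Proof. by move=> _ [b _ <-]; exact: (cm_ge0 dP). Qed.

Lemma dist_to_ge0 B z : 0 <= dist_to B z.
Proof. exact: capped_inf_ge0. Qed.

Lemma dist_to_le B z b : B b -> dist_to B z <= d z b.
Proof. by move=> Bb; apply: capped_inf_le => //; exists b. Qed.

Lemma dist_to_mem B z : B z -> dist_to B z = 0.
Proof.
move=> Bz; apply: le_anti; rewrite dist_to_ge0 andbT -(cm_xx dP z).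
exact: dist_to_le.
Qed.

(** The cap makes this true for empty [B] as well, a case that occurs when [B] is the complement of
    a neighborhood. *)
Lemma dist_to_gt0 B z : closed B -> ~ B z -> 0 < dist_to B z.
Proof.
move=> cB Bz; have : nbhs z (~` B).
  by apply: open_nbhs_nbhs; split=> //; rewrite openC.
move=> /(cm_nbhsP dP)[e e0 eB]; apply: (@lt_le_trans _ _ (Num.min e 1)).
  by rewrite lt_min e0 ltr01.
apply: capped_inf_ge; first by rewrite ge_min lexx orbT.
move=> _ [b Bb <-]; rewrite ge_min; apply/orP; left; rewrite leNgt.
by apply/negP => /eB.
Qed.

Lemma dist_to_lip B z w : dist_to B w <= dist_to B z + d z w.
Proof.
apply: capped_inf_leD => //; first exact: (cm_ge0 dP).
move=> _ [b Bb <-]; exists (d w b); first by exists b.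
by rewrite addrC (cm_sym dP z w); exact: (cm_tri dP).
Qed.

Lemma dist_to_continuous B : continuous (dist_to B).
Proof.
move=> z; apply/cvgrPdist_lt => e e0; near=> w.
apply: (@le_lt_trans _ _ (d z w)); last by near: w; exact: (cm_near dP).
have := dist_to_lip B z w; have := dist_to_lip B w z.
by rewrite (cm_sym dP w z) ler_norml => ? ?; apply/andP; split; lra.
Unshelve. all: by end_near. Qed.

End DistanceToSet.

Lemma dist_to_invariant {R : realType} {G : topologicalGroupType}
    (Z : gSpaceType G) (d : Z -> Z -> R) (B : set Z) :
  invariant_metric d -> invariant_set B ->
  forall g z, dist_to (d := d) B (gact g z) = dist_to (d := d) B z.
Proof.
move=> [_ dG _] Bi g z; rewrite /dist_to; congr capped_inf.
apply/seteqP; split=> _ [b Bb <-].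
  by exists (gact g^-1%g b); [exact: Bi|rewrite -(dG g) -gactM mulgV gact1].
by exists (gact g b); [exact: Bi|rewrite dG].
Qed.

Section AbsoluteNeighborhoodExtension.
Context {R : realType} {G : topologicalGroupType}.
Hypothesis G_compact : compact [set: G].
Context {X : gSpaceType G} (x0 : X).
Hypothesis X_ANR : G_ANR R X.

(** [Z] is mapped to the ambient space of [X] by Hausdorff's formula, with the distance [delta] to
    [range j] as height; over [j y] the image is the embedded point [phi y]. The group merely
    permutes the terms of the infimum, which gives equivariance. The main work is continuity in the
    supremum norm, uniform in [a]. *)
Lemma G_ANR_neighborhood_extension (Y Z : gSpaceType G) (j : Y -> Z)
    (phi : Y -> X) :
  metrizable R Z -> closed_G_embedding j -> G_map phi ->
  exists (O : set Z) (Phi : Z -> X),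
    [/\ open O, invariant_set O,
        forall z, O z -> Phi w @[w --> z] --> Phi z,
        forall g z, O z -> Phi (gact g z) = gact g (Phi z) &
        forall y, O (j y) /\ Phi (j y) = phi y].
Proof.
move=> /(exists_invariant_metric G_compact)[dZ dZI] [[jc jG] jinj jO jcl].
move=> [phic phiG].
have [d dI] : exists d : X -> X -> R, invariant_metric d.
  by apply: exists_invariant_metric G_compact _ _; case: X_ANR.
have [dP dG d1] := dI; have [dZP dZG dZ1] := dZI.
have dG' g x y : d x (gact g^-1%g y) = d (gact g x) y.
  by rewrite -(dG g) -gactM mulgV gact1.
pose delta := dist_to (d := dZ) (range j).
have range_inv : invariant_set (range j).
  by move=> g _ [y _ <-]; exists (gact g y).
have deltaG g z : delta (gact g z) = delta z by exact: dist_to_invariant.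
have deltaj y : delta (j y) = 0 by apply: (dist_to_mem dZP); exists y.
have delta0 z : 0 <= delta z by exact: (dist_to_ge0 dZP).
have delta_gt0 z : ~ (exists y, j y = z) -> 0 < delta z.
  move=> h; apply: (dist_to_gt0 dZP) => // -[y _ yz]; apply: h.
  by exists y.
have delta_le z y : delta z <= dZ z (j y).
  by apply: (dist_to_le dZP); exists y.
have delta_c : continuous delta by exact: (dist_to_continuous dZP).
(* Hausdorff's formula for the Tietze extension of d (phi _) a. *)
pose Q z a := [set d (phi y) a + (dZ z (j y) / delta z - 1) | y in [set: Y]].
have Q0 z a : 0 < delta z -> nonneg (Q z a).
  move=> z0 _ [y _ <-]; apply: addr_ge0; first exact: (cm_ge0 dP).
  by rewrite subr_ge0 ler_pdivlMr// mul1r.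
(* On [range j] the formula would divide by [delta z = 0], so the value is prescribed there. *)
pose h z a := if pselect (exists y, j y = z) is left p then
  d (phi (sval (cid p))) a else capped_inf (Q z a).
have hj y : h (j y) = d (phi y).
  apply/funext => a; rewrite /h; case: pselect => [p|[]]; last by exists y.
  by rewrite (jinj _ _ (svalP (cid p))).
have hn z a : 0 < delta z -> h z a = capped_inf (Q z a).
  move=> z0; rewrite /h; case: pselect => // p; exfalso.
  by case: p z0 => y <-; rewrite deltaj ltxx.
have zP z : (exists y, z = j y) \/ 0 < delta z.
  have [[y <-]|] := pselect (exists y, j y = z); first by left; exists y.
  by move/delta_gt0; right.
have h1 z : unit_valued (h z).
  move=> a; have [[y ->]|z0] := zP z; first by rewrite hj (cm_ge0 dP) d1.
  by rewrite hn// capped_inf_ge0 ?capped_inf_le1//; exact: Q0.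
have hG g z a : h (gact g z) a = h z (gact g^-1%g a).
  have [[y ->]|z0] := zP z; first by rewrite -jG !hj phiG dG'.
  have gz0 : 0 < delta (gact g z) by rewrite deltaG.
  rewrite !hn//; congr capped_inf; apply/seteqP; split=> _ [y _ <-].
    exists (gact g^-1%g y) => //; rewrite dG' -phiG -gactM mulgV gact1 deltaG.
    by rewrite -[dZ z _](dZG g) -jG -gactM mulgV gact1.
  by exists (gact g y) => //; rewrite phiG dG' jG dZG deltaG.
have hc z e : 0 < e -> \forall w \near z, forall a, `|h z a - h w a| < e.
  move=> e0; have [[y0 ->]|z0] := zP z.
    pose e1 : R := Num.min (e / 4) 1.
    have e10 : 0 < e1 by rewrite lt_min ltr01 andbT divr_gt0.
    have e11 : e1 <= 1 by rewrite ge_min lexx orbT.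
    have e14 : e1 <= e / 4 by rewrite ge_min lexx.
    have : nbhs y0 [set y | d (phi y0) (phi y) < e1].
      exact: (phic y0 _ (cm_near dP (phi y0) e10)).
    rewrite nbhsE => -[A [oA Ay0] Ae]; have [B oB AB] := (jO A).1 oA.
    have /(cm_nbhsP dZP)[eta eta0 etaB] : nbhs (j y0) B.
      by apply: open_nbhs_nbhs; split=> //; rewrite AB in Ay0.
    have etaP y : dZ (j y0) (j y) < eta -> d (phi y0) (phi y) < e1.
      by move=> /etaB By; apply: Ae; rewrite AB.
    (* For [w] within eta / 3 of [j y0], each [j y] at distance at least eta from [j y0] satisfies
       dZ w (j y) >= 2 delta w, so its term is at least 1 and cannot lower the infimum below
       [d (phi y0) a]. The bound 1 / 2 keeps [(1 + e1) * delta w] below the cap. *)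
    pose rho : R := Num.min (eta / 3) (1 / 2).
    have rho0 : 0 < rho by rewrite lt_min; apply/andP; split; lra.
    have rho3 : rho <= eta / 3 by rewrite ge_min lexx.
    have rho2 : rho <= 1 / 2 by rewrite ge_min lexx orbT.
    apply: filterS (cm_near dZP _ rho0) => w yw a.
    rewrite hj; have [[y wy]|w0] := zP w.
      rewrite wy hj; apply: le_lt_trans (cm_lip dP _ _ _ _) _.
      rewrite (cm_xx dP) addr0; have := etaP y; rewrite -wy; lra.
    have dw : delta w < rho.
      by apply: le_lt_trans (delta_le _ y0) _; rewrite (cm_sym dZP).
    have lb : d (phi y0) a - e1 <= h w a.
      rewrite hn//; apply: capped_inf_ge; first by have := d1 (phi y0) a; lra.
      move=> _ [y _ <-]; have [/etaP y0y|] := ltP (dZ (j y0) (j y)) eta.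
        have : 1 <= dZ w (j y) / delta w by rewrite ler_pdivlMr// mul1r.
        have := cm_tri dP (phi y) (phi y0) a; lra.
      move=> y0y; have : 2 <= dZ w (j y) / delta w.
        rewrite ler_pdivlMr//; have := cm_tri dZP w (j y0) (j y); lra.
      have := d1 (phi y0) a; have := cm_ge0 dP (phi y) a; lra.
    (* A point [j y] that realizes [delta w] up to the factor [1 + e1] is within eta of [j y0]; its
       term costs one [e1] for the quotient and one for the distance from [phi y0] to [phi y]. *)
    have ub : h w a <= d (phi y0) a + 2 * e1.
      have [||_ [y _ <-] wy] := @capped_inf_lt _ (range (fun y => dZ w (j y)))
          ((1 + e1) * delta w).
      - have -> : capped_inf (range (fun y => dZ w (j y))) = delta w.
          congr capped_inf; apply/seteqP; split=> [_ [y _ <-]|_ [_ [y _ <-]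
            <-]].
            by exists (j y) => //; exists y.
          by exists y.
        by rewrite ltr_pMl// ltrDl.
      - nra.
      have wy2 : dZ w (j y) < 2 * rho by nra.
      have : dZ (j y0) (j y) < eta.
        have := cm_tri dZP w (j y0) (j y); lra.
      move=> /etaP y0y; rewrite hn//.
      apply: le_trans (capped_inf_le (Q0 _ _ w0) _) _; first by exists y.
      have : dZ w (j y) / delta w <= 1 + e1 by rewrite ler_pdivrMr// ltW.
      have := cm_tri dP (phi y0) (phi y) a; rewrite (cm_sym dP (phi y) (phi
        y0)); lra.
    by rewrite ltr_norml; apply/andP; split; lra.
  (* A bound, independent of [y] and [a], for the change of the quotients between [z] and [w]; the
     second summand relies on [dZ <= 1]. *)
  pose t w := dZ z w / delta w + `|(delta z)^-1 - (delta w)^-1|.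
  have tc : t w @[w --> z] --> (0 : R).
    have -> : (0 : R) = 0 / delta z + `|(delta z)^-1 - (delta z)^-1|.
      by rewrite mul0r subrr normr0 addr0.
    have ic : (delta w)^-1 @[w --> z] --> (delta z)^-1.
      by apply: cvgV; [rewrite gt_eqF|exact: delta_c].
    apply: cvgD.
      apply: cvgM => //; rewrite -(cm_xx dZP z).
      by apply: (cm_cvg2 dZP); [exact: cvg_cst|exact: cvg_id].
    by apply: cvg_norm; apply: cvgB => //; exact: cvg_cst.
  have t0 w : 0 < delta w -> 0 <= t w.
    by move=> w0; rewrite addr_ge0// divr_ge0// (cm_ge0 dZP).
  have tP w y : 0 < delta w ->
      `|dZ w (j y) / delta w - dZ z (j y) / delta z| <= t w.
    move=> w0.
    have -> : dZ w (j y) / delta w - dZ z (j y) / delta z =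
      (dZ w (j y) - dZ z (j y)) / delta w +
      dZ z (j y) * ((delta w)^-1 - (delta z)^-1) by ring.
    apply: le_trans (ler_normD _ _) _; apply: lerD.
      rewrite normrM normfV (gtr0_norm w0) ler_pM2r ?invr_gt0//.
      apply: le_trans (cm_lip dZP _ _ _ _) _.
      by rewrite (cm_xx dZP) addr0 (cm_sym dZP).
    rewrite normrM distrC ger0_norm ?(cm_ge0 dZP)//.
    by rewrite ler_piMl.
  near=> w => a.
  have w0 : 0 < delta w by near: w; exact: (cvgr_gt _ (delta_c z)).
  apply: (@le_lt_trans _ _ (t w)); last first.
    by near: w; exact: (cvgr_lt _ tc).
  have := @capped_inf_leD _ (Q z a) (Q w a) (t w) (Q0 _ _ z0) (t0 _ w0).
  have := @capped_inf_leD _ (Q w a) (Q z a) (t w) (Q0 _ _ w0) (t0 _ w0).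
  rewrite -!hn// => h1' h2'; rewrite ler_norml; apply/andP; split.
    suff : h w a <= h z a + t w by lra.
    apply: h1' => _ [y _ <-].
    exists (d (phi y) a + (dZ w (j y) / delta w - 1)); first by exists y.
    by have := tP w y w0; rewrite ler_norml => /andP[]; lra.
  suff : h z a <= h w a + t w by lra.
  apply: h2' => _ [y _ <-].
  exists (d (phi y) a + (dZ z (j y) / delta z - 1)); first by exists y.
  by have := tP w y w0; rewrite ler_norml => /andP[]; lra.
have [||O [Phi [oO Oi Phic PhiG Phij]]] := ambient_extension x0 dI X_ANR
  _ h1 delta0 _ hG deltaG hc delta_c.
- move=> z; rewrite -[X in _ --> X]gact1.
  by apply: gact_cvg; [exact: cvg_id|exact: cvg_cst].
- move=> z z0; have [[y ->]|] := zP z; first by exists (phi y).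
  by rewrite z0 ltxx.
- by exists O, Phi; split=> // y; apply: Phij.
Unshelve. all: by end_near. Qed.

End AbsoluteNeighborhoodExtension.

(** * Equivariant local equiconnectedness *)

Section Clamp.
Context {R : realType}.

Definition clamp (t : R) : R := Num.max 0 (Num.min 1 t).

Lemma clamp_ge0 t : 0 <= clamp t.
Proof. by rewrite le_max lexx. Qed.

Lemma clamp_le1 t : clamp t <= 1.
Proof. by rewrite ge_max ler01 ge_min lexx. Qed.

Lemma clamp_id t : 0 <= t <= 1 -> clamp t = t.
Proof. by move=> /andP[t0 t1]; rewrite /clamp (min_idPr t1) (max_idPr t0). Qed.

Lemma clamp0 : clamp 0 = 0.
Proof. by rewrite clamp_id// lexx ler01. Qed.

Lemma clamp1 : clamp 1 = 1.
Proof. by rewrite clamp_id// lexx ler01. Qed.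

Lemma clamp_continuous : continuous clamp.
Proof.
apply: max_fun_continuous; first exact: cst_continuous.
by apply: min_fun_continuous; [exact: cst_continuous|move=> t; exact: cvg_id].
Qed.

Lemma clamp_mem t : clamp t \in unit_interval R.
Proof. by rewrite inE /unit_interval /= in_itv /= clamp_ge0 clamp_le1. Qed.

(** A retraction of the line onto the interval; it lets homotopies defined on the subtype be run
    with a real parameter. *)
Definition to_unit t : unit_interval R := SigSub (clamp_mem t).

Lemma to_unit_continuous : continuous to_unit.
Proof.
move=> t A [B [[C oC CB] Bt BA]].
have nC : nbhs (clamp t) C.
  by apply: open_nbhs_nbhs; split=> //; move: Bt; rewrite -CB.
have : \forall u \near t, C (clamp u) by exact: clamp_continuous nC.
apply: filterS => u Cu; apply: BA.
by rewrite -CB.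
Qed.

Lemma to_unit_val (t : unit_interval R) : to_unit (set_val t) = t.
Proof.
apply: val_inj => /=; apply: clamp_id.
by have := set_mem (valP t); rewrite /unit_interval /= in_itv.
Qed.

Lemma set_val_unit_continuous : continuous (set_val : unit_interval R -> R).
Proof. exact: initial_continuous. Qed.

End Clamp.

Section Equiconnected.
Context {R : realType} {G : topologicalGroupType}.
Hypothesis G_compact : compact [set: G].
Context {X : gSpaceType G} (x0 : X).

(* The equivariant form of local equiconnectedness. *)
Definition equiconnecting (D : set (X * X)) (c : X * X -> R -> X) :=
  [/\ open D, forall x, D (x, x) &
      forall g x y, D (x, y) -> D (gact g x, gact g y)] /\
  [/\ forall p t, D p -> c q.1 q.2 @[q --> (p, t)] --> c p t,
      forall g x y t, D (x, y) ->
        c (gact g x, gact g y) t = gact g (c (x, y) t),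
      forall x t, c (x, x) t = x,
      forall p, D p -> c p 0 = p.1 & forall p, D p -> c p 1 = p.2].

Lemma near_unit_interval (A : topologicalType) (P : A -> R -> Prop) (a : A) :
  (forall t : R, 0 <= t <= 1 -> \forall q \near (a, t), P q.1 q.2) ->
  \forall b \near a, forall t : R, 0 <= t <= 1 -> P b t.
Proof.
move=> aP.
have h (t : R) : `[0, 1]%classic t -> \forall p \near (t, a), P p.2 p.1.
  rewrite /= in_itv /= => /aP [[N1 N2] /= [aN1 tN2] NP].
  by exists (N2, N1) => //= -[u b] [/= uN bN]; apply: (NP (b, u)).
have := @near_compact R A `[0, 1]%classic (fun t b => P b t) a
  (@segment_compact R 0 1) h.
apply: filterS => b hb t t01; apply: hb.
by rewrite /= in_itv.
Qed.

(** The path [c (x, x)] is constant, so continuity at each (x, x, t) and the tube lemma over [0, 1]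
    confine whole paths between points near [x]. *)
Lemma equiconnecting_small (D : set (X * X)) (c : X * X -> R -> X) (x : X) W :
  equiconnecting D c -> nbhs x W -> exists2 N, nbhs x N &
  forall y z, N y -> N z ->
    D (y, z) /\ forall t : R, 0 <= t <= 1 -> W (c (y, z) t).
Proof.
move=> [[oD Dx _] [cc _ cxx _ _]] Wx.
have nD : nbhs (x, x) D by apply: open_nbhs_nbhs; split.
have nW : \forall p \near (x, x), forall t : R, 0 <= t <= 1 -> W (c p t).
  apply: near_unit_interval => t _.
  have h := cc (x, x) t (Dx x).
  by apply: h; rewrite cxx.
have [[N1 N2] /= [xN1 xN2] NP] := filterI nD nW.
exists (N1 `&` N2); first exact: filterI.
move=> y z [y1 y2] [z1 z2].
by have [] := NP (y, z) (conj y1 z2).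
Qed.

(** The path from [x] to [y] is the retracted image of the segment (1 - t) d x + t d y, lifted to
    height t (1 - t) d(x, y). The height vanishes only at the ends or when x = y, exactly where the
    segment is known to lie in the embedded [X]; the factor d(x, y) is what makes [c (x, x)]
    constant. *)
Lemma G_ANR_equiconnecting :
  G_ANR R X -> exists D c, equiconnecting D c.
Proof.
move=> X_ANR.
have [d dI] : exists d : X -> X -> R, invariant_metric d.
  by apply: exists_invariant_metric G_compact _ _; case: X_ANR.
have [dP dG d1] := dI.
have dG' g x y : d x (gact g^-1%g y) = d (gact g x) y.
  by rewrite -(dG g) -gactM mulgV gact1.
pose A : topologicalType := (X * X * R)%type.
pose act g (a : A) : A := (gact g a.1.1, gact g a.1.2, a.2).
pose h (a : A) x := (1 - clamp a.2) * d a.1.1 x + clamp a.2 * d a.1.2 x.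
pose s (a : A) := clamp a.2 * (1 - clamp a.2) * d a.1.1 a.1.2.
have c1 (a : A) : a.1.1 @[a --> a] --> a.1.1.
  by apply: continuous_comp; exact: cvg_fst.
have c2 (a : A) : a.1.2 @[a --> a] --> a.1.2.
  by apply: continuous_comp; [exact: cvg_fst|exact: cvg_snd].
have c3 (a : A) : clamp a.2 @[a --> a] --> clamp a.2.
  by apply: continuous_comp; [exact: cvg_snd|exact: clamp_continuous].
have c4 (a : A) : 1 - clamp a.2 @[a --> a] --> 1 - clamp a.2.
  by apply: cvgB; [exact: cvg_cst|exact: c3].
have [||||||||O [Phi [oO Oi Phic PhiG PhiE]]] := @ambient_extension _ _ _ d x0
  dI X_ANR A
  act h s.
- have gc (z : X) : gact g z @[g --> (1%g : G)] --> z.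
    rewrite -[X in _ --> X]gact1.
    by apply: gact_cvg; [exact: cvg_id|exact: cvg_cst].
  move=> [[x y] t].
  apply: (@cvg_pair _ _ _ _ (nbhs (x, y)) (nbhs t) _ _ _
    (fun g : G => (gact g x, gact g y)) (fun=> t)); last exact: cvg_cst.
  exact: cvg_pair.
- move=> a x; rewrite /h; have := clamp_ge0 a.2; have := clamp_le1 a.2.
  have := cm_ge0 dP a.1.1 x; have := cm_ge0 dP a.1.2 x.
  by have := d1 a.1.1 x; have := d1 a.1.2 x => *; apply/andP; split; nra.
- move=> a; rewrite /s mulr_ge0 ?(cm_ge0 dP)// mulr_ge0 ?clamp_ge0//.
  by rewrite subr_ge0 clamp_le1.
- move=> [[x y] t]; rewrite /s /h /= => /eqP.
  rewrite !mulf_eq0 => /orP[/orP[/eqP->|]|/eqP /(cm_eq dP) ->].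
  + by exists x; apply/funext => z; rewrite subr0 mul1r mul0r addr0.
  + rewrite subr_eq0 => /eqP <-.
    by exists y; apply/funext => z; rewrite subrr mul1r mul0r add0r.
  + by exists y; apply/funext => z; ring.
- by move=> g [[x y] t] z; rewrite /h /= !dG'.
- by move=> g [[x y] t]; rewrite /s /= dG.
- move=> a e e0; have e40 : 0 < e / 4 by rewrite divr_gt0.
  have /(cm_cvg dP)/(_ _ e40) n1 := c1 a.
  have /(cm_cvg dP)/(_ _ e40) n2 := c2 a.
  have /cvgrPdist_lt/(_ _ e40) n3 := c3 a.
  near=> b => x.
  have m1 : d a.1.1 b.1.1 < e / 4 by near: b.
  have m2 : d a.1.2 b.1.2 < e / 4 by near: b.
  have m3 : `|clamp a.2 - clamp b.2| < e / 4 by near: b.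
  have -> : h a x - h b x = (1 - clamp a.2) * (d a.1.1 x - d b.1.1 x) +
     clamp a.2 * (d a.1.2 x - d b.1.2 x) +
     (clamp a.2 - clamp b.2) * (d b.1.2 x - d b.1.1 x) by rewrite /h; ring.
  apply: (@le_lt_trans _ _ (e / 4 + e / 4 + e / 4)); last lra.
  apply: le_trans (ler_normD _ _) _; apply: lerD.
    apply: le_trans (ler_normD _ _) _; apply: lerD; rewrite normrM.
      apply: le_trans (ltW m1); rewrite -[leRHS]mul1r; apply: ler_pM => //.
        rewrite ger0_norm; have := clamp_ge0 a.2; have := clamp_le1 a.2; lra.
      by apply: le_trans (cm_lip dP _ _ _ _) _; rewrite (cm_xx dP) addr0.
    apply: le_trans (ltW m2); rewrite -[leRHS]mul1r; apply: ler_pM => //.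
      by rewrite ger0_norm ?clamp_ge0 ?clamp_le1.
    by apply: le_trans (cm_lip dP _ _ _ _) _; rewrite (cm_xx dP) addr0.
  rewrite normrM -[leRHS]mulr1; apply: ler_pM => //; first exact: ltW.
  have := cm_ge0 dP b.1.1 x; have := cm_ge0 dP b.1.2 x.
  have := d1 b.1.1 x; have := d1 b.1.2 x => *.
  by rewrite ler_norml; apply/andP; split; lra.
- move=> a; rewrite /s; apply: cvgM; last exact: (cm_cvg2 dP (c1 a) (c2 a)).
  by apply: cvgM; [exact: c3|exact: c4].
(* The whole lifted segment has to stay in the domain of the retraction; the tube lemma makes this
   an open condition. *)
pose D : set (X * X) := [set p | forall t : R, 0 <= t <= 1 -> O (p, t)].
pose c (p : X * X) t := Phi (p, clamp t).
have DO p t : D p -> O (p, clamp t).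
  by apply; rewrite clamp_ge0 clamp_le1.
exists D, c; split; split.
- rewrite openE => p Dp.
  apply: (@near_unit_interval (X * X)%type (fun p t => O (p, t))) => t t01.
  have : nbhs (p, t) O by apply: open_nbhs_nbhs; split=> //; exact: Dp.
  by apply: filterS => -[].
- move=> x t t01; apply: (PhiE (x, x, t) x _ _).1.
    by rewrite /s /= (cm_xx dP) mulr0.
  by rewrite /h /=; apply/funext => y; ring.
- by move=> g x y Dxy t /Dxy /(Oi g).
- move=> p t Dp; rewrite /c.
  apply: (@cvg_comp _ _ _ (fun q : (X * X) * R => (q.1, clamp q.2)) Phi _
    (nbhs (p, clamp t))); last by apply: Phic; exact: DO.
  exact: (@cvg_pair _ _ _ _ (nbhs p) (nbhs (clamp t)) _ _ _ fst
    (fun q : (X * X) * R => clamp q.2) cvg_fst (c3 (p, t))).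
- by move=> g x y t Dxy; rewrite /c -PhiG//; exact: DO.
- move=> x t; apply: (PhiE (x, x, clamp t) x _ _).2.
    by rewrite /s /= (cm_xx dP) mulr0.
  by rewrite /h /=; apply/funext => y; ring.
- move=> [x y] Dp; rewrite /c; apply: (PhiE (x, y, clamp 0) x _ _).2.
    by rewrite /s /= !clamp0 !mul0r.
  by rewrite /h /= !clamp0; apply/funext => z; ring.
- move=> [x y] Dp; rewrite /c; apply: (PhiE (x, y, clamp 1) y _ _).2.
    by rewrite /s /= !clamp1 subrr mulr0 mul0r.
  by rewrite /h /= !clamp1; apply/funext => z; ring.
Unshelve. all: by end_near. Qed.

End Equiconnected.

(** * Left homotopy inverses with metric control *)

Lemma equiconnecting_cvg {R : realType} {G : topologicalGroupType}
    {X : gSpaceType G} {D : set (X * X)} {c : X * X -> R -> X} {U : Type}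
    {F : set_system U} {FF : Filter F} (h k : U -> X) (s : U -> R) x y t :
  equiconnecting D c -> D (x, y) -> h @ F --> x -> k @ F --> y -> s @ F --> t ->
  c (h u, k u) (s u) @[u --> F] --> c (x, y) t.
Proof.
move=> [_ [cc _ _ _ _]] Dxy hx ky st.
apply: (@cvg_comp _ _ _ (fun u => ((h u, k u), s u))
  (fun q : (X * X) * R => c q.1 q.2) _ (nbhs ((x, y), t))); last exact: cc.
apply: (@cvg_pair _ _ _ F (nbhs (x, y)) (nbhs t) _ _ _ (fun u => (h u, k u)) s).
  exact: (@cvg_pair _ _ _ F (nbhs x) (nbhs y)).
exact: st.
Qed.

Section CoverRadius.
Context {R : realType} {Y : topologicalType} (d : Y -> Y -> R).
Hypothesis dP : compatible_metric d.

(** A positive 1-Lipschitz function, serving as a tolerance that varies over [Y]. *)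
Definition radius (delta : Y -> R) :=
  (forall y, 0 < delta y) /\ forall y z, delta y <= delta z + d y z.

Lemma radius_continuous delta : radius delta -> continuous delta.
Proof.
move=> [_ dl] y; apply/cvgrPdist_lt => e e0; near=> z.
apply: (@le_lt_trans _ _ (d y z)); last by near: z; exact: (cm_near dP).
have := dl y z; have := dl z y.
by rewrite (cm_sym dP z y) ler_norml => ? ?; apply/andP; split; lra.
Unshelve. all: by end_near. Qed.

Lemma radius_min delta (e : R) : 0 < e -> radius delta ->
  radius (fun y => Num.min e (delta y)).
Proof.
move=> e0 [d0 dl]; split=> [y|y z]; first by rewrite lt_min e0 d0.
have := dl y z; have := cm_ge0 dP y z.
by rewrite /Num.min; case: (ltP e (delta y)); case: (ltP e (delta z)); lra.
Qed.

(** A Lebesgue number depending on the point: the supremum of the radii at most 1 of balls contained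
    in a member of the cover is positive and 1-Lipschitz in the center. *)
Lemma open_cover_radius (V : set (set Y)) : open_cover V ->
  exists2 delta, radius delta &
    forall y, exists2 W, V W & forall z, d y z <= delta y -> W z.
Proof.
move=> [Vo VT].
pose E y := [set r : R | 0 <= r <= 1 /\
  exists2 W, V W & forall z, d y z < r -> W z].
have Vy y : exists2 W, V W & W y.
  by have : [set: Y] y by []; rewrite -VT => -[W VW Wy]; exists W.
have E0 y : E y 0.
  split; first by rewrite lexx ler01.
  have [W VW _] := Vy y; exists W => // z.
  by rewrite ltNge (cm_ge0 dP).
have Eub y : has_ubound (E y) by exists 1 => r [/andP[]].
have Ele y r : E y r -> r <= sup (E y) by apply: ub_le_sup.
have sup_gt0 y : 0 < sup (E y).
  have [W VW Wy] := Vy y.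
  have /(cm_nbhsP dP)[e e0 eW] : nbhs y W.
    by apply: open_nbhs_nbhs; split=> //; exact: Vo.
  apply: (@lt_le_trans _ _ (Num.min e 1)); first by rewrite lt_min e0 ltr01.
  apply: Ele; split.
    by rewrite le_min ltW// ler01 /= ge_min lexx orbT.
  by exists W => // z; rewrite lt_min => /andP[/eW].
have sup_lip y z : sup (E y) <= sup (E z) + d y z.
  apply: ge_sup; first by exists 0.
  move=> r [/andP[r0 r1] [W VW rW]]; rewrite -lerBlDr.
  have [rd|/ltW rd] := leP 0 (r - d y z); last first.
    exact: le_trans rd (ltW (sup_gt0 z)).
  apply: Ele; split; first by rewrite rd /=; have := cm_ge0 dP y z; lra.
  by exists W => // w zw; apply: rW; have := cm_tri dP z y w; lra.
(* The supremum need not be attained; half of it is below an admissible radius, so even the closed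
   ball fits into one member. *)
exists (fun y => sup (E y) / 2).
  split=> [y|y z]; first by rewrite divr_gt0.
  by have := sup_lip y z; have := cm_ge0 dP y z; lra.
move=> y; apply: contrapT => h.
suff : sup (E y) <= sup (E y) / 2 by have := sup_gt0 y; lra.
apply: ge_sup; first by exists 0.
move=> r [_ [W VW rW]]; rewrite leNgt; apply/negP => yr; apply: h.
by exists W => // z yz; apply: rW; exact: le_lt_trans yr.
Qed.

End CoverRadius.

Section ControlledInverse.
Context {R : realType} {G : topologicalGroupType} {X Y : gSpaceType G}.
Variables (f : X -> Y) (d : Y -> Y -> R).
Hypothesis f_G_map : G_map f.
Hypothesis f_dense : dense (range f).
Hypothesis f_left_inverse : forall U : set (set Y), open_cover U ->
  exists phi : Y -> X,
    G_map phi /\ G_cover_homotopic R (preimage_cover f U) (phi \o f) idfun.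
Hypothesis dP : compatible_metric d.

Definition controlled_left_inverse (delta : Y -> R) (phi : Y -> X)
    (F : X * unit_interval R -> X) :=
  [/\ G_map phi, G_homotopy F,
      forall x, F (x, I0 R) = phi (f x) /\ F (x, I1 R) = x,
      forall x t, d (f x) (f (F (x, t))) <= delta (f x) &
      forall y, d y (f (phi y)) <= delta y].

(* That f phi is close to the identity on the dense set f(X) is part of the
   control on the homotopy; a continuous radius lets it pass to the closure. *)
Lemma exists_controlled_left_inverse delta : radius d delta ->
  exists phi F, controlled_left_inverse delta phi F.
Proof.
move=> dr; have [d0 dl] := dr.
(* If [f x] lies in the ball about [y], then delta y < (4/3) delta (f x) by the Lipschitz condition,
   so any other point of the ball is within (2/3) delta (f x) of [f x]. *)
pose U := range (fun y => [set z | d y z < delta y / 4]).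
have Uc : open_cover U.
  split; last first.
    apply/seteqP; split=> // y _; exists [set z | d y z < delta y / 4].
      by exists y.
    by rewrite /= (cm_xx dP) divr_gt0.
  move=> _ [y _ <-]; rewrite openE => z /= yz; apply/(cm_nbhsP dP).
  exists (delta y / 4 - d y z) => [|w]; first by rewrite subr_gt0.
  by have := cm_tri dP z y w => *; rewrite /=; lra.
have [phi [phiG [F [[Fh FU] F0 F1]]]] := f_left_inverse Uc.
have [phic _] := phiG; have [fc _] := f_G_map.
have Fd x t : d (f x) (f (F (x, t))) <= delta (f x).
  have [_ [_ [y _ <-] <-] /= FV] := FU x.
  have := FV (I1 R); rewrite F1 /= => yx.
  have := FV t; have := cm_tri dP y (f x) (f (F (x, t))).
  rewrite (cm_sym dP (f x) y); have := dl y (f x); have := d0 (f x); lra.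
exists phi, F; split => //.
move=> y; rewrite leNgt; apply/negP => yd.
have gc z : d z (f (phi z)) - delta z @[z --> z] --> d z (f (phi z)) - delta z.
  apply: cvgB; last exact: (radius_continuous dP dr).
  apply: (cm_cvg2 dP); first exact: cvg_id.
  by apply: continuous_comp; [exact: phic|exact: fc].
have : nbhs y [set z | 0 < d z (f (phi z)) - delta z].
  by apply: (cvgr_gt _ (gc y)); rewrite subr_gt0.
rewrite nbhsE => -[B [oB By] BV].
have [z [Bz [x _ xE]]] := f_dense (ex_intro _ y By) oB.
have := BV _ Bz; rewrite -xE /=; have := Fd x (I0 R); rewrite F0 /=; lra.
Qed.

End ControlledInverse.

(** * Fine equivalences onto a G-ANR *)

Section FineEquivalence.
Context {R : realType} {G : topologicalGroupType} {X Y : gSpaceType G}.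
Hypothesis G_compact : compact [set: G].
Variable f : X -> Y.
Hypothesis f_G_map : G_map f.
Hypothesis f_dense : dense (range f).
Hypothesis f_left_inverse : forall U : set (set Y), open_cover U ->
  exists phi : Y -> X,
    G_map phi /\ G_cover_homotopic R (preimage_cover f U) (phi \o f) idfun.

Lemma G_ANR_fine_G_homotopy_equivalence (y0 : Y) :
  G_ANR R Y -> fine_G_homotopy_equivalence R f.
Proof.
move=> Y_ANR; split => // U [Uo UT].
have [d dP] : exists d : Y -> Y -> R, compatible_metric d by case: Y_ANR.
have [D [c Dc]] := G_ANR_equiconnecting G_compact y0 Y_ANR.
have [[_ _ _] [_ cG cxx c0 c1]] := Dc.
(* The sets [N] form a cover refining [U] so finely that connecting paths between points of [N] stay
   in one member of [U]. Control by its radius puts both [y] and [f (phi y)] into such an [N]. *)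
pose small N W := [/\ U W, open N & forall y z, N y -> N z ->
  D (y, z) /\ forall t : R, 0 <= t <= 1 -> W (c (y, z) t)].
have [|delta dr deltaN] := @open_cover_radius R Y d dP
    [set N | exists W, small N W].
  split; first by move=> N [W []].
  apply/seteqP; split=> // y _; have : [set: Y] y by [].
  rewrite -UT => -[W UW Wy].
  have nW : nbhs y W by apply: open_nbhs_nbhs; split=> //; exact: Uo.
  have [N yN NW] := equiconnecting_small Dc nW.
  exists N^°; last exact: nbhs_singleton (nbhs_interior yN).
  exists W; split=> //; first exact: open_interior.
  by move=> z w /interior_subset Nz /interior_subset Nw; exact: NW.
have [phi [F [phiG Fh F01 Fd phid]]] :=
  exists_controlled_left_inverse f_G_map f_dense f_left_inverse dP dr.
have [phic phiG'] := phiG; have [fc fG] := f_G_map.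
exists phi; split => //.
  exists F; split=> [|x|x]; try by have [] := F01 x.
  split=> // x.
  have [N [W [UW oN NW]] NB] := deltaN (f x).
  exists (f @^-1` W); first by exists W.
  move=> t /=; have Nt := NB _ (Fd x t).
  (* The path from a point of [N] to itself is constant and lies in [W], so [N] is contained in
     [W]. *)
  have [_ /(_ 0)] := NW _ _ Nt Nt.
  by rewrite cxx lexx ler01; apply.
have DN y : exists2 W, U W & D (f (phi y), y) /\
    forall t : R, 0 <= t <= 1 -> W (c (f (phi y), y) t).
  have [N [W [UW oN NW]] NB] := deltaN y; exists W => //; apply: NW.
    exact: NB.
  by apply: NB; rewrite (cm_xx dP) ltW//; case: dr.
have Dy y : D (f (phi y), y) by have [W _ []] := DN y.
exists (fun q => c (f (phi q.1), q.1) (set_val q.2)); split.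
- split; first split.
  + move=> [y t]; apply: (equiconnecting_cvg Dc (Dy y)).
    * apply: continuous_comp; first by apply: continuous_comp; [exact:
        cvg_fst|exact: phic].
      exact: fc.
    * exact: cvg_fst.
    * by apply: continuous_comp; [exact: cvg_snd|exact:
        set_val_unit_continuous].
  + by move=> g y t /=; rewrite phiG' fG cG.
  + move=> y; have [W UW [_ yW]] := DN y; exists W => // t /=.
    apply: yW; have := set_mem (valP t).
    by rewrite /unit_interval /= in_itv.
- by move=> y /=; rewrite c0.
- by move=> y /=; rewrite c1.
Qed.

End FineEquivalence.

(** * Telescopes of homotopies *)

Section Dyadic.
Context {R : realType}.

Definition dyadic k : R := 2^-1 ^+ k.

Lemma dyadic_gt0 k : 0 < dyadic k.
Proof. by rewrite exprn_gt0// invr_gt0. Qed.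

Lemma dyadicS k : dyadic k = 2 * dyadic k.+1.
Proof. by rewrite /dyadic exprS mulrA mulfV ?mul1r. Qed.

Lemma dyadic_le k m : (k <= m)%N -> dyadic m <= dyadic k.
Proof. by move=> km; apply: ler_wiXn2l => //; rewrite ?invf_le1 ?ler1n. Qed.

Lemma dyadic_le1 k : dyadic k <= 1.
Proof. by have := @dyadic_le 0 k isT; rewrite {2}/dyadic expr0. Qed.

Lemma dyadic_lt_inv k m : dyadic k < dyadic m -> (m < k)%N.
Proof. by rewrite ltnNge => h; apply/negP => /dyadic_le; rewrite leNgt h. Qed.

Lemma dyadic_small e : 0 < e -> exists k, dyadic k < e.
Proof.
move=> e0; have : (@GRing.exp R 2^-1) @ \oo --> (0 : R).
  by apply: cvg_expr; rewrite gtr0_norm ?invr_gt0// invf_lt1// ltr1n.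
move=> /cvgrPdist_lt/(_ _ e0) [k _ /(_ k (leqnn k))] /=.
rewrite sub0r normrN gtr0_norm; last exact: dyadic_gt0.
by move=> ke; exists k.
Qed.

(** Here [k.+1] is the least exponent whose power is below [t]; it is not 0 because t <= 1. *)
Lemma dyadic_slot t : 0 < t <= 1 -> exists k, dyadic k.+1 < t <= dyadic k.
Proof.
move=> /andP[/dyadic_small ex t1].
case: (ex_minnP ex) => -[|k] kt kmin.
  by move: kt; rewrite /dyadic expr0 ltNge t1.
exists k; rewrite kt leNgt; apply/negP => /kmin.
by rewrite ltnn.
Qed.

Lemma dyadic_slot_inj t k m :
  dyadic k.+1 < t <= dyadic k -> dyadic m.+1 < t <= dyadic m -> k = m.
Proof.
move=> /andP[k1 k2] /andP[m1 m2]; apply/eqP; rewrite eqn_leq.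
by rewrite -ltnS (dyadic_lt_inv (lt_le_trans m1 k2)) -ltnS
  (dyadic_lt_inv (lt_le_trans k1 m2)).
Qed.

End Dyadic.

Section Telescope.
Context {R : realType} {G : topologicalGroupType}.
Hypothesis G_compact : compact [set: G].
Context {Z : gSpaceType G} (d : Z -> Z -> R).
Hypothesis dI : invariant_metric d.

Let dP : compatible_metric d. Proof. by case: dI. Qed.

(** The Urysohn functions [a k] vanish exactly on [C] and equal 1 off [V k]; [theta] is the supremum
    of the 2 * 2^-k * a_k. Off [V k] it is at least 2 * 2^-k, and the factor 2 makes this exceed
    2^-k, which gives the last clause. *)
Lemma exists_clock (C : set Z) (V : nat -> set Z) :
  closed C -> invariant_set C ->
  (forall k, open (V k)) -> (forall k, invariant_set (V k)) ->
  (forall k, C `<=` V k) ->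
  exists theta : Z -> R,
    [/\ continuous theta, forall g z, theta (gact g z) = theta z,
        forall z, C z -> theta z = 0, forall z, ~ C z -> 0 < theta z &
        forall k z, theta z <= dyadic k -> V k z].
Proof.
move=> cC iC oV iV CV.
pose D := dist_to (d := d) C; pose E k := dist_to (d := d) (~` V k).
have cVc k : closed (~` V k) by rewrite closedC.
have D0 z : 0 <= D z by exact: (dist_to_ge0 dP).
have E0 k z : 0 <= E k z by exact: (dist_to_ge0 dP).
have Dgt0 z : ~ C z -> 0 < D z by exact: (dist_to_gt0 dP).
have DE k z : 0 < D z + E k z.
  have [Cz|/Dgt0 Dz] := pselect (C z); last exact: ltr_wpDr.
  by apply: ltr_wpDl => //; apply: (dist_to_gt0 dP) => // /(_ (CV k z Cz)).
pose a k z := D z / (D z + E k z).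
have a0 k z : 0 <= a k z by rewrite divr_ge0// ltW.
have a1 k z : a k z <= 1 by rewrite ler_pdivrMr// mul1r lerDl.
have ac k : continuous (a k).
  move=> z; apply: cvgM; first exact: (dist_to_continuous dP).
  apply: cvgV; first by rewrite gt_eqF.
  by apply: cvgD; exact: (dist_to_continuous dP).
have aG k g z : a k (gact g z) = a k z.
  have Ei : invariant_set (~` V k).
    move=> h x Vx /(iV k h^-1%g).
    by rewrite -gactM mulVg gact1.
  by rewrite /a /D /E !dist_to_invariant.
pose S z := range (fun k => 2 * dyadic k * a k z).
have S2 k z : 0 <= 2 * dyadic k * a k z <= 2 * dyadic k.
  have h0 : 0 <= 2 * dyadic k :> R by rewrite mulr_ge0// ltW// dyadic_gt0.
  by rewrite mulr_ge0//= ler_piMr.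
have Sub z : has_ubound (S z).
  exists 2 => _ [k _ <-]; have /andP[_ h] := S2 k z; apply: le_trans h _.
  by rewrite ler_piMr// dyadic_le1.
pose theta z := sup (S z).
have le_theta k z : 2 * dyadic k * a k z <= theta z by apply: ub_le_sup => //;
  exists k.
have theta_le z e : (forall k, 2 * dyadic k * a k z <= e) -> theta z <= e.
  move=> h; apply: ge_sup; first by exists (2 * dyadic 0%N * a 0%N z), 0%N.
  by move=> _ [k _ <-].
have theta0 z : 0 <= theta z.
  by apply: le_trans (le_theta 0%N z); have /andP[] := S2 0%N z.
exists theta; split.
- move=> z; apply/cvgrPdist_lt => e e0.
  (* Terms of index at least [N] lie in [0, e / 2], and only finitely many others have to be
     controlled near [z]. *)
  have [N Ne] : exists N, 2 * dyadic N < e / 2.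
    have [|N] := @dyadic_small R (e / 4); first by rewrite divr_gt0.
    by exists N; lra.
  have near_a n : \forall w \near z, forall k, (k < n)%N ->
      `|a k z - a k w| < e / 4.
    elim: n => [|n IH]; first by apply: nearW.
    have e40 : 0 < e / 4 by rewrite divr_gt0.
    have /cvgrPdist_lt/(_ _ e40) := ac n z.
    apply: filterS2 IH => w wn awn k; rewrite ltnS leq_eqVlt => /orP[/eqP->//|].
    exact: wn.
  apply: filterS (near_a N) => w wN.
  have term k : `|2 * dyadic k * a k z - 2 * dyadic k * a k w| <= e / 2.
    have [kN|Nk] := ltnP k N.
      rewrite -mulrBr normrM ger0_norm; last by have := @dyadic_gt0 R k; lra.
      have h1 := @dyadic_le1 R k.
      have := @dyadic_gt0 R k; have := wN k kN; have := normr_ge0 (a k z - a k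
        w).
      nra.
    have := @dyadic_le R N k Nk; have /andP[] := S2 k z; have /andP[] := S2 k w.
    by rewrite ler_norml => *; apply/andP; split; lra.
  apply: (@le_lt_trans _ _ (e / 2)); last lra.
  rewrite ler_norml; apply/andP; split.
    suff : theta w <= theta z + e / 2 by lra.
    apply: theta_le => k; have := le_theta k z.
    by have := term k; rewrite ler_norml => /andP[]; lra.
  suff : theta z <= theta w + e / 2 by lra.
  apply: theta_le => k; have := le_theta k w.
  by have := term k; rewrite ler_norml => /andP[]; lra.
- move=> g z; rewrite /theta; suff -> : S (gact g z) = S z by [].
  rewrite /S; have -> // : (fun k => 2 * dyadic k * a k (gact g z)) =
    (fun k => 2 * dyadic k * a k z).
  by apply/funext => k; rewrite aG.
- move=> z Cz; apply: le_anti; rewrite theta0 andbT; apply: theta_le => k.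
  by rewrite /a /D (dist_to_mem dP Cz) mul0r mulr0.
- move=> z /Dgt0 Dz; apply: lt_le_trans (le_theta 0%N z).
  by rewrite mulr_gt0// ?divr_gt0// mulr_gt0// dyadic_gt0.
- move=> k z zk; apply: contrapT => Vz.
  have az : a k z = 1.
    rewrite /a /E (dist_to_mem dP (B := ~` V k))// addr0 divff// gt_eqF//.
    by apply: Dgt0 => /(CV k).
  have := le_theta k z; rewrite az mulr1; have := @dyadic_gt0 R k; lra.
Qed.

Context {Y : gSpaceType G} (dY : Y -> Y -> R) (j : Y -> Z).
Hypothesis dYP : compatible_metric dY.
Hypothesis j_emb : closed_G_embedding j.

(** While [theta] runs down through the slot from 2^-k to 2^-(k+1), the retraction runs through the
    homotopy [L k] from 0 to 1. [Lglue] gives continuity at the ends of the slots, and [eps k]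
    tending to 0 gives it at [range j]. *)
Lemma telescope_retraction (L : nat -> Z -> R -> Y) (O : nat -> set Z)
    (eps : nat -> R) :
  (forall k, open (O k)) -> (forall k y, O k (j y)) ->
  (forall k z s, O k z -> L k q.1 q.2 @[q --> (z, s)] --> L k z s) ->
  (forall k g z s, O k z -> L k (gact g z) s = gact g (L k z s)) ->
  (forall k z, O k z -> O k.+1 z -> L k z 1 = L k.+1 z 0) ->
  (forall k, 0 < eps k) ->
  (forall e, 0 < e -> exists N, forall k, (N <= k)%N -> eps k < e) ->
  (forall k y s, 0 <= s <= 1 -> dY y (L k (j y) s) < eps k) ->
  exists U : set Z, [/\ invariant_set U, set_nbhs (range j) U &
    exists r : U -> Y, G_retraction j r].
Proof.
move=> oO Oj Lc LG Lglue eps0 epsc Leps.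
have [[jc jG] jinj jopen jcl] := j_emb.
(* One and the same [y] has to be close to [z] in [Z] and to the whole path [L k z] in [Y]: this
   ties the value of the retraction to the position of [z]. *)
pose P k z := O k z /\ exists2 y, d z (j y) < eps k &
  forall s, 0 <= s <= 1 -> dY y (L k z s) < eps k.
have nP k y : nbhs (j y) (P k).
  have n1 : nbhs (j y) (O k) by apply: open_nbhs_nbhs.
  have n2 := cm_near dP (j y) (eps0 k).
  have n3 : \forall z \near j y, forall s : R, 0 <= s <= 1 ->
      dY y (L k z s) < eps k.
    apply: (@near_unit_interval R Z (fun z s => dY y (L k z s) < eps k)).
    move=> s s01.
    have c : dY y (L k q.1 q.2) @[q --> (j y, s)] --> dY y (L k (j y) s).
      by apply: (cm_cvg2 dYP); [exact: cvg_cst|exact: Lc].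
    exact: (cvgr_lt _ c _ (Leps k y s s01)).
  near=> z; split; first by near: z.
  exists y; last by near: z.
  by rewrite (cm_sym dP); near: z.
(* [dY] is not assumed invariant, so [P k] need not be. Asking for whole orbits repairs this, and
   compactness of [G] keeps the set open. *)
pose V k := [set z | forall g : G, [set: G] g -> (P k)^° (gact g z)].
have oV k : open (V k).
  rewrite openE => z Vz.
  apply: (near_compact (P := fun g z => (P k)^° (gact g z)) G_compact).
  move=> g _.
  have c : gact q.1 q.2 @[q --> (g, z)] --> gact g z.
    exact: (@gact_continuous G Z (g, z)).
  exact: c (nbhs_interior (Vz g I)).
have iV k : invariant_set (V k).
  by move=> g z Vz h _; rewrite -gactM; exact: Vz.
have CV k : range j `<=` V k by move=> _ [y _ <-] g _; rewrite -jG; exact: nP.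
have VP k z : V k z -> P k z.
  by move=> /(_ 1%g I) /interior_subset; rewrite gact1.
have iC : invariant_set (range j).
  by move=> g _ [y _ <-]; exists (gact g y).
have [theta [tc tG tC tC0 tV]] := exists_clock jcl iC oV iV CV.
(* Outside (0, 1] the index is arbitrary. *)
have /choice[idx idxP] : forall t : R, exists k,
    0 < t <= 1 -> dyadic k.+1 < t <= dyadic k.
  move=> t; have [/dyadic_slot[k kt]|h] := boolP (0 < t <= 1); first by exists
    k.
  by exists 0%N.
(* The parameter is 0 at theta = 2^-k and 1 at theta = 2^-(k+1). *)
pose M k z := L k z (2 - theta z / dyadic k.+1).
pose r z := if pselect (exists y, j y = z) is left p then sval (cid p)
  else M (idx (theta z)) z.
have rj y : r (j y) = y.
  rewrite /r; case: pselect => [p|[]]; last by exists y.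
  exact: jinj (svalP (cid p)).
have rn z : 0 < theta z -> r z = M (idx (theta z)) z.
  move=> z0; rewrite /r; case: pselect => // p; exfalso.
  by case: p z0 => y <-; rewrite tC ?ltxx//; exists y.
have zP z : (exists y, z = j y) \/ 0 < theta z.
  have [[y _ <-]|/tC0] := pselect (range j z); first by left; exists y.
  by right.
have Mc k z : O k z -> M k w @[w --> z] --> M k z.
  move=> Oz.
  apply: (@cvg_comp _ _ _ (fun w => (w, 2 - theta w / dyadic k.+1))
    (fun q : Z * R => L k q.1 q.2) _ (nbhs (z, 2 - theta z / dyadic k.+1)));
    last exact: Lc.
  have c : 2 - theta w / dyadic k.+1 @[w --> z] --> 2 - theta z / dyadic k.+1.
    apply: cvgB; first exact: cvg_cst.
    by apply: cvgM; [exact: tc|exact: cvg_cst].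
  exact: (@cvg_pair _ _ _ (nbhs z) (nbhs z) (nbhs _) _ _ _ id _ cvg_id c).
have rc z : theta z < 1 -> r w @[w --> z] --> r z.
  move=> z1; have [[y0 ->]|z0] := zP z.
    apply/(cm_cvg dYP) => e e0; rewrite rj.
    have : nbhs y0 [set y | dY y0 y < e / 2].
      by apply: (cm_near dYP); rewrite divr_gt0.
    rewrite nbhsE => -[A [oA Ay0] Ae]; have [B oB AB] := (jopen A).1 oA.
    have /(cm_nbhsP dP)[eta eta0 etaB] : nbhs (j y0) B.
      by apply: open_nbhs_nbhs; split=> //; rewrite AB in Ay0.
    have etaP y : d (j y0) (j y) < eta -> dY y0 y < e / 2.
      by move=> /etaB By; apply: Ae; rewrite AB.
    have m0 : 0 < Num.min (e / 2) (eta / 2) by rewrite lt_min !divr_gt0.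
    have [N Nm] := epsc _ m0.
    have tj0 : theta (j y0) = 0 by apply: tC; exists y0.
    have n1 : \forall w \near j y0, theta w < dyadic N.
      by apply: (cvgr_lt _ (tc (j y0))); rewrite tj0 dyadic_gt0.
    have n2 : \forall w \near j y0, theta w < 1.
      by apply: (cvgr_lt _ (tc (j y0))); rewrite tj0.
    have n3 : \forall w \near j y0, d (j y0) w < eta / 2.
      by apply: (cm_near dP); rewrite divr_gt0.
    apply: filterS3 n1 n2 n3 => w w1 w2 w3.
    have [[y wy]|w0] := zP w.
      by rewrite wy rj; have := etaP y; rewrite -wy; lra.
    have /andP[k1 k2] := idxP (theta w) (introT andP (conj w0 (ltW w2))).
    (* This says N < k + 1 for the index k of the slot, that is, N <= k. *)
    have Nk := dyadic_lt_inv (lt_trans k1 w1).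
    have := Nm _ Nk; rewrite lt_min => /andP[ke keta].
    have [Ok [y wy ys]] := VP _ _ (tV _ _ k2).
    rewrite rn// /M.
    have : 0 <= 2 - theta w / dyadic (idx (theta w)).+1 <= 1.
      have h0 := @dyadic_gt0 R (idx (theta w)).+1.
      have u1 : theta w / dyadic (idx (theta w)).+1 <= 2.
        by rewrite ler_pdivrMr// -dyadicS.
      have : 1 <= theta w / dyadic (idx (theta w)).+1.
        by rewrite ler_pdivlMr// mul1r ltW.
      by move=> u2; apply/andP; split; lra.
    move=> /ys; set Lw := L _ _ _ => yL.
    have : dY y0 y < e / 2.
      by apply: etaP; have := cm_tri dP w (j y0) (j y); lra.
    by have := cm_tri dYP y y0 Lw; lra.
  have z01 : 0 < theta z <= 1 by rewrite z0 ltW.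
  have /andP[k1 k2] := idxP _ z01; set k := idx (theta z) in k1 k2.
  have Ok : O k z by have [] := VP _ _ (tV _ _ k2).
  have rzk : r z = M k z by rewrite rn.
  have n1 : \forall w \near z, dyadic k.+1 < theta w.
    exact: (cvgr_gt _ (tc z)).
  have rw w m : dyadic m.+1 < theta w <= dyadic m -> r w = M m w.
    move=> /andP[m1 m2].
    have w0 : 0 < theta w by apply: lt_trans m1; exact: dyadic_gt0.
    have w1 : theta w <= 1.
      exact: le_trans m2 (dyadic_le1 m).
    rewrite rn//; congr (M _ _); apply: dyadic_slot_inj (idxP _ _) _.
      by rewrite w0 w1.
    by rewrite m1 m2.
  have [zk|kz] := ltP (theta z) (dyadic k).
    have n2 : \forall w \near z, theta w < dyadic k by exact: (cvgr_lt _ (tc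
      z)).
    rewrite rzk; move=> W /(Mc k z Ok) nW.
    have {}nW : \forall w \near z, W (M k w) by exact: nW.
    apply: filterS3 n1 n2 nW => w w1 w2 Ww.
    by rewrite /= (rw w k)// w1 ltW.
  (* At the upper end of slot [k] the pieces [M k] and [M k.-1] meet, and they agree at [z] by
     [Lglue]. For k = 0 there is no earlier piece, but theta z < 1 excludes that end. *)
  have zk : theta z = dyadic k by apply: le_anti; rewrite kz k2.
  case: k => [|m] in k1 k2 Ok rzk n1 kz zk *.
    by move: z1; rewrite zk /dyadic expr0 ltxx.
  have zm : dyadic m.+1 < dyadic m :> R by rewrite [ltRHS]dyadicS; have :=
    @dyadic_gt0 R m.+1; lra.
  have Om : O m z.
    by have [] := VP m z (tV m z _); rewrite // zk ltW.
  have n2 : \forall w \near z, theta w < dyadic m.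
    by apply: (cvgr_lt _ (tc z)); rewrite zk.
  have Mm : M m z = M m.+1 z.
    rewrite /M zk divff ?gt_eqF ?dyadic_gt0// [X in _ - X / _]dyadicS mulfK;
      last first.
      by rewrite gt_eqF ?dyadic_gt0.
    rewrite subrr -Lglue//; congr (L m z _); lra.
  rewrite rzk; move=> W W1.
  have nW1 : \forall w \near z, W (M m.+1 w) by exact: (Mc _ z Ok).
  have nW2 : \forall w \near z, W (M m w) by apply: (Mc _ z Om); rewrite /= Mm.
  suff : \forall w \near z, W (r w) by [].
  near=> w.
  have w1 : dyadic m.+2 < theta w by near: w.
  have w2 : theta w < dyadic m by near: w.
  have [wm|mw] := leP (theta w) (dyadic m.+1).
    have -> : r w = M m.+1 w by apply: rw; rewrite w1 wm.
    by near: w.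
  have -> : r w = M m w by apply: rw; rewrite mw ltW.
  by near: w.
have rG g z : theta z < 1 -> r (gact g z) = gact g (r z).
  move=> z1; have [[y ->]|z0] := zP z; first by rewrite -jG !rj.
  rewrite !rn ?tG// /M tG LG//.
  have /andP[_ k2] := idxP (theta z) (introT andP (conj z0 (ltW z1))).
  by have [] := VP _ _ (tV _ _ k2).
exists [set z | theta z < 1]; split.
- by move=> g z; rewrite /= tG.
- move=> _ [y _ <-]; apply: (cvgr_lt _ (tc (j y))).
  by rewrite tC//; exists y.
- exists (fun u => r (set_val u)); split.
  + move=> u; apply: continuous_comp; first exact: initial_continuous.
    by apply: rc; exact: (set_mem (valP u)).
  + by move=> g u v ->; apply: rG; exact: (set_mem (valP u)).
  + by move=> y u ->.
Unshelve. all: by end_near. Qed.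

End Telescope.

(** * Spaces finely dominated by a G-ANR *)

Section ApproximatingSequence.
Context {R : realType} {G : topologicalGroupType} {X Y : gSpaceType G}.
Hypothesis G_compact : compact [set: G].
Variables (f : X -> Y) (d : Y -> Y -> R).
Hypothesis X_ANR : G_ANR R X.
Hypothesis f_G_map : G_map f.
Hypothesis f_dense : dense (range f).
Hypothesis f_left_inverse : forall U : set (set Y), open_cover U ->
  exists phi : Y -> X,
    G_map phi /\ G_cover_homotopic R (preimage_cover f U) (phi \o f) idfun.
Hypothesis dP : compatible_metric d.
Variables (D : set (X * X)) (c : X * X -> R -> X).
Hypothesis Dc : equiconnecting D c.

Let fc : continuous f. Proof. by case: f_G_map. Qed.
Let fG g x : f (gact g x) = gact g (f x). Proof. by case: f_G_map. Qed.

(** Supplies the short paths followed by the even stages of the telescope. *)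
Definition linked n (phi phi' : Y -> X) := forall y,
  D (phi y, phi (f (phi' y))) /\ forall t : R, 0 <= t <= 1 ->
    d (f (phi y)) (f (c (phi y, phi (f (phi' y))) t)) < dyadic n.

(** Small sets [N] of [X], between whose points the paths are short after [f], pull back under [phi]
    to a cover of [Y]. If [f phi'] is close to the identity relative to this cover, then [y] and
    [f (phi' y)] lie in one such preimage. The minimum of two radii also gives the control
    2^-(n+1). *)
Lemma exists_linked n phi : G_map phi -> exists phi' F',
  controlled_left_inverse f d (fun=> dyadic n.+1) phi' F' /\ linked n phi phi'.
Proof.
move=> [phic phiG].
have [[_ _ _] [_ _ _ c0 _]] := Dc.
pose small N := open N /\ forall x y, N x -> N y ->
  D (x, y) /\ forall t : R, 0 <= t <= 1 -> d (f x) (f (c (x, y) t)) < dyadic n.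
have [|delta dr deltaN] := open_cover_radius dP
    (V := [set phi @^-1` N | N in small]).
  split.
    by move=> _ [N [oN _] <-]; apply: open_comp => // x _; exact: phic.
  apply/seteqP; split=> // y _.
  have h2 : 0 < dyadic n / 2 :> R by rewrite divr_gt0// dyadic_gt0.
  have nW : nbhs (phi y) [set x | d (f (phi y)) (f x) < dyadic n / 2].
    exact: (fc (x := phi y) (cm_near dP (f (phi y)) h2)).
  have [N yN NW] := equiconnecting_small Dc nW.
  exists (phi @^-1` N^°); last exact: nbhs_singleton (nbhs_interior yN).
  exists N^° => //; split; first exact: open_interior.
  move=> x z /interior_subset Nx /interior_subset Nz.
  have [Dxz xz] := NW _ _ Nx Nz; split=> // t t01.
  (* Time 0 gives the bound for [f x] itself; the two halves of 2^-n then add up. *)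
  have := xz _ t01; have := xz 0; rewrite lexx ler01 => /(_ isT) /=.
  rewrite (c0 (x, z))//= => h h'.
  apply: le_lt_trans (cm_tri dP (f (phi y)) _ _) _.
  by rewrite (cm_sym dP (f x)); lra.
have dr' := radius_min dP (dyadic_gt0 n.+1) dr.
have [phi' [F [phiG' Fh F01 Fd phid]]] :=
  exists_controlled_left_inverse f_G_map f_dense f_left_inverse dP dr'.
exists phi', F; split.
  split => // [x t|y]; first by apply: le_trans (Fd x t) _; rewrite ge_min lexx.
  by apply: le_trans (phid y) _; rewrite ge_min lexx.
move=> y; have [_ [N [oN NP] <-] Ny] := deltaN y.
apply: NP.
  by apply: Ny; rewrite (cm_xx dP) ltW//; case: dr.
by apply: Ny; apply: le_trans (phid y) _; rewrite ge_min lexx orbT.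
Qed.

Lemma exists_linked_sequence : exists phi F,
  (forall n, controlled_left_inverse f d (fun=> dyadic n) (phi n) (F n)) /\
  forall n, linked n (phi n) (phi n.+1).
Proof.
pose state := ((Y -> X) * (X * unit_interval R -> X))%type.
pose good n (s : state) := controlled_left_inverse f d (fun=> dyadic n) s.1 s.2.
have [phi0 [F0 s0]] : exists phi F,
    controlled_left_inverse f d (fun=> dyadic 0) phi F.
  apply: (exists_controlled_left_inverse f_G_map f_dense f_left_inverse dP).
  split=> [y|y z]; first exact: dyadic_gt0.
  by rewrite lerDl (cm_ge0 dP).
(* For dependent choice the successor is made total: a state that is not good is left unchanged. *)
have /choice[next nextP] : forall p : nat * state, exists s' : state,
    good p.1 p.2 -> good p.1.+1 s' /\ linked p.1 p.2.1 s'.1.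
  move=> [n s] /=; have [h|h] := pselect (good n s); last by exists s.
  have [phi' [F' h']] : exists phi' F',
    controlled_left_inverse f d (fun=> dyadic n.+1) phi' F' /\ linked n s.1
      phi'.
    by apply: exists_linked; case: h.
  by exists (phi', F').
pose s := nat_rect (fun=> state) (phi0, F0) (fun n s => next (n, s)).
have sP n : good n (s n).
  by elim: n => [//|n IH]; have [] := nextP (n, s n) IH.
exists (fun n => (s n).1), (fun n => (s n).2); split=> n; first exact: sP.
by have [] := nextP (n, s n) (sP n).
Qed.

(** Two stages of the telescope lead from [f (E n z)] to [f (E n.+1 z)]: stage 2n follows the path
    from [E n z] to [E' n z], and stage 2n + 1 the homotopy [F n] from [E' n z] to [E n.+1 z]. *)
Lemma dominated_G_retraction (x0 : X) (Z : gSpaceType G) (j : Y -> Z) :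
  metrizable R Z -> closed_G_embedding j ->
  exists U : set Z, [/\ invariant_set U, set_nbhs (range j) U &
    exists r : U -> Y, G_retraction j r].
Proof.
move=> Zm jE.
have [dZ dZI] := exists_invariant_metric G_compact Zm.
have [phi [F [phiP link]]] := exists_linked_sequence.
have phiG n : G_map (phi n) by case: (phiP n).
have phic n : continuous (phi n) by case: (phiG n).
have phig n g y : phi n (gact g y) = gact g (phi n y) by case: (phiG n).
have [[oD _ _] [_ cG _ c0 c1]] := Dc.
have /choice[Phi PhiP] : forall n, exists P : set Z * (Z -> X),
    [/\ open P.1, invariant_set P.1,
        forall z, P.1 z -> P.2 w @[w --> z] --> P.2 z,
        forall g z, P.1 z -> P.2 (gact g z) = gact g (P.2 z) &
        forall y, P.1 (j y) /\ P.2 (j y) = phi n y].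
  move=> n; have [V [Phi h]] :=
    G_ANR_neighborhood_extension G_compact x0 X_ANR Zm jE (phiG n).
  by exists (V, Phi).
pose U n := (Phi n).1; pose E n := (Phi n).2.
have oU n : open (U n) by case: (PhiP n).
have Ec n z : U n z -> E n w @[w --> z] --> E n z
  by have [_ _ h _ _] := PhiP n; exact: h.
have Eg n g z : U n z -> E n (gact g z) = gact g (E n z).
  by have [_ _ _ h _] := PhiP n; exact: h.
have Uj n y : U n (j y) by have [_ _ _ _ /(_ y)[]] := PhiP n.
have Ej n y : E n (j y) = phi n y by have [_ _ _ _ /(_ y)[]] := PhiP n.
pose E' n z := phi n (f (E n.+1 z)).
have Ec' n z : U n.+1 z -> E' n w @[w --> z] --> E' n z.
  move=> /Ec h; apply: (@continuous_comp _ _ _ (f \o E n.+1) (phi n)).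
    by apply: continuous_comp; [exact: h|exact: fc].
  exact: phic.
pose O n := [set z | [/\ U n z, U n.+1 z & D (E n z, E' n z)]].
have oO n : open (O n).
  rewrite openE => z [Uz Uz' Dz].
  have n1 : \forall w \near z, U n w by apply: open_nbhs_nbhs.
  have n2 : \forall w \near z, U n.+1 w by apply: open_nbhs_nbhs.
  have n3 : \forall w \near z, D (E n w, E' n w).
    have nD : nbhs (E n z, E' n z) D by apply: open_nbhs_nbhs; split.
    exact: (@cvg_pair _ _ _ (nbhs z) (nbhs (E n z)) (nbhs (E' n z)) _ _ _
      (E n) (E' n) (Ec _ _ Uz) (Ec' _ _ Uz') _ nD).
  by apply: filterS3 n1 n2 n3 => w ? ? ?.
have Oj n y : O n (j y).
  by split=> //; rewrite /E' !Ej; case: (link n y).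
have F0 n x : F n (x, to_unit 0) = phi n (f x).
  by have [_ _ /(_ x)[<- _] _ _] := phiP n; rewrite -(to_unit_val (I0 R)).
have F1 n x : F n (x, to_unit 1) = x.
  by have [_ _ /(_ x)[_ {2}<-] _ _] := phiP n; rewrite -(to_unit_val (I1 R)).
pose L k z s := if odd k then f (F k./2 (E k./2.+1 z, to_unit s))
  else f (c (E k./2 z, E' k./2 z) s).
apply: (telescope_retraction G_compact dZI dP jE (L := L)
  (O := fun k => O k./2) (eps := fun k => 2 * dyadic k./2)) => //.
- move=> k z s [Uz Uz' Dz]; rewrite /L; case: odd.
    have [_ [Fc _] _ _ _] := phiP k./2.
    apply: continuous_comp; last exact: fc.
    apply: (@cvg_comp _ _ _
      (fun q : Z * R => (E k./2.+1 q.1, to_unit q.2)) (F k./2) _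
      (nbhs (E k./2.+1 z, to_unit s))); last exact: Fc.
    apply: (@cvg_pair _ _ _ (nbhs (z, s)) (nbhs (E k./2.+1 z))
      (nbhs (to_unit s)) _ _ _ (fun q => E k./2.+1 q.1) (fun q => to_unit q.2)).
      by apply: continuous_comp; [exact: cvg_fst|exact: Ec].
    by apply: continuous_comp; [exact: cvg_snd|exact: to_unit_continuous].
  apply: (@cvg_comp _ _ _
    (fun q : Z * R => c (E k./2 q.1, E' k./2 q.1) q.2) f _
    (nbhs (c (E k./2 z, E' k./2 z) s))); last exact: fc.
  apply: (equiconnecting_cvg (h := fun q : Z * R => E k./2 q.1)
    (k := fun q => E' k./2 q.1) Dc Dz); last exact: cvg_snd.
    exact: (cvg_comp _ _ cvg_fst (Ec _ _ Uz)).
  exact: (cvg_comp _ _ cvg_fst (Ec' _ _ Uz')).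
- move=> k g z s [Uz Uz' Dz]; rewrite /L /E'; case: odd.
    by have [_ [_ Fg] _ _ _] := phiP k./2; rewrite Eg// Fg fG.
  by rewrite !Eg// fG phig cG.
(* Half of k + 1 is n + 1 after an odd stage and n after an even one, where n is half of k. The
   common values are [f (E n.+1 z)] and [f (E' n z)] respectively. *)
- move=> k z [Uz Uz' Dz] [Vz Vz' Dz']; rewrite /L /= uphalf_half.
  move: Vz Vz' Dz'; rewrite /= uphalf_half; case: odd => /= Vz Vz' Dz'.
    by rewrite F1 add1n (c0 (_, _)).
  by rewrite (c1 (_, _))// add0n F0.
- by move=> k; rewrite mulr_gt0// dyadic_gt0.
- move=> e e0; have [|N Ne] := @dyadic_small R (e / 2); first by rewrite
    divr_gt0.
  exists N.*2 => k Nk; have : dyadic k./2 <= dyadic N :> R by apply: dyadic_le;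
    lia.
  by lra.
(* Even stages stay within 2^-n + 2^-n of [y], the second bound being strict; odd stages stay within
   2^-(n+1) + 2^-n. *)
- move=> k y s s01; rewrite /L /E' !Ej; set n := k./2.
  have h0 := @dyadic_gt0 R n; have hS := @dyadicS R n.
  have [_ _ _ Fd phid] := phiP n; have [_ _ _ _ phid'] := phiP n.+1.
  case: odd.
    apply: le_lt_trans (cm_tri dP (f (phi n.+1 y)) _ _) _.
    have := phid' y; have := Fd (phi n.+1 y) (to_unit s).
    by have := @dyadic_gt0 R n.+1; lra.
  apply: le_lt_trans (cm_tri dP (f (phi n y)) _ _) _.
  have := phid y; have [_ /(_ s s01)] := link n y; lra.
Qed.

End ApproximatingSequence.

(** The constructions above use a base point, so the empty space is treated apart; the empty
    neighborhood works. *)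
Lemma G_ANR_empty (R : realType) (G : topologicalGroupType) (Y : gSpaceType G) :
  (Y -> False) -> metrizable R Y -> G_ANR R Y.
Proof.
move=> Y0 Ym; split=> // Z i _ _; exists set0; split=> //.
  by move=> z [y _ _]; case: (Y0 y).
have e0 (u : set0 : set Z) : False by exact: (set_mem (valP u)).
exists (fun u => False_rect _ (e0 u)); split.
- by move=> u; case: (e0 u).
- by move=> g u; case: (e0 u).
- by move=> y; case: (Y0 y).
Qed.

Theorem theorem4p3 (R : realType) (G : topologicalGroupType)
    (G_compact : compact [set: G]) (G_hausdorff : hausdorff_space G)
    (X Y : gSpaceType G) (f : X -> Y)
    (X_ANR : G_ANR R X) (Y_metrizable : metrizable R Y) (f_G_map : G_map f)
    (f_dense : dense (range f))
    (f_left_inverse : forall U : set (set Y), open_cover U ->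
      exists phi : Y -> X,
        G_map phi /\
        G_cover_homotopic R (preimage_cover f U) (phi \o f) idfun) :
  fine_G_homotopy_equivalence R f /\ G_ANR R Y.
Proof.
have [[y0 _]|Y0] := pselect (exists y : Y, True); last first.
  have {}Y0 (y : Y) : False by apply: Y0; exists y.
  split; last exact: G_ANR_empty.
  split=> // U Uc; have [phi [phiG phiH]] := f_left_inverse U Uc.
  exists phi; split=> //; exists fst; split; [|by move=> y; case: (Y0 y)..].
  split; last by move=> y; case: (Y0 y).
  by split=> [[y t]|g y]; case: (Y0 y).
(* Density of the image turns a point of [Y] into a base point of [X]. *)
have [_ [_ [x0 _ _]]] := f_dense setT (ex_intro _ y0 I) openT.
have [d dP] : exists d : Y -> Y -> R, compatible_metric d by [].
have [D [c Dc]] := G_ANR_equiconnecting G_compact x0 X_ANR.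
have Y_ANR : G_ANR R Y.
  split=> // Z j; exact: (dominated_G_retraction G_compact X_ANR f_G_map f_dense
    f_left_inverse dP Dc x0).
split=> //; exact: (G_ANR_fine_G_homotopy_equivalence G_compact f_G_map f_dense
  f_left_inverse y0 Y_ANR).
Qed.
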